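(* Let $r\ge1$, $p_1,\ldots,p_r\ge1$ and $q>1$ be integers, and let $e_j\in\{p_j,\bar p_j\}$ for $j=1,\dots,r$. (i) If the weight $p_1+\cdots+p_r+q$ and the order $r$ are of the same parity, then the (alternating) Euler $R$-sum $R_{e_1e_2\cdots e_r,q}$ reduces to a combination of sums of lower orders. (ii) If the weight $p_1+\cdots+p_r+q$ and the order $r$ are of different parity, then the (alternating) Euler $R$-sum $R_{e_1e_2\cdots e_r,\bar q}$ reduces to a combination of sums of lower orders.
   Context: $H_n^{(p)}=\sum_{k=1}^n k^{-p}$ and $\bar H_n^{(p)}=\sum_{k=1}^n(-1)^{k-1}k^{-p}$ (both $0$ for $n=0$). For $e_j\in\{p_j,\bar p_j\}$ put $X_n^{(e_j)}=H_n^{(p_j)}$ if $e_j=p_j$ and $X_n^{(e_j)}=\bar H_n^{(p_j)}$ if $e_j=\bar p_j$. The (alternating) Euler $R$-sums of order $r$ are $$R_{e_1\cdots e_r,q}=\sum_{n=0}^\infty\frac{X_n^{(e_1)}\cdots X_n^{(e_r)}}{(n+1/2)^q},\qquad R_{e_1\cdots e_r,\bar q}=\sum_{n=0}^\infty\frac{X_n^{(e_1)}\cdots X_n^{(e_r)}}{(n+1/2)^q}(-1)^n.$$ Single values: $\zeta(k)=\sum_{n\ge1}n^{-k}$ and $R(k)=\sum_{n\ge1}(n-1/2)^{-k}$ for $k\ge2$, $R(1):=2\log2$; $\zeta(\bar k)=\sum_{n\ge1}(-1)^nn^{-k}$ and $R(\bar k)=\sum_{n\ge1}(-1)^n(n-1/2)^{-k}$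 for $k\ge1$. ''Reduces to a combination of sums of lower orders'' means: is a polynomial with rational coefficients in (alternating) Euler $R$-sums of order strictly less than $r$ (with last index, barred or not, at least $2$) and the single values $\zeta(k),\zeta(\bar k),R(k),R(\bar k)$. *)

(* Defs.v *)
From HB Require Import structures.
From mathcomp Require Import all_boot all_order all_algebra.
From mathcomp Require Import all_classical all_reals all_analysis.
(* Not imported: the notations of mpoly clash with those of all_analysis. *)
From mathcomp Require mpoly.
Set Implicit Arguments.
Unset Strict Implicit.
Unset Printing Implicit Defensive.
Import Order.TTheory GRing.Theory Num.Theory.
Import numFieldNormedType.Exports.
Local Open Scope ring_scope.

(* The library has this notation only for extended reals. The limit of the
   partial sums also covers the conditionally convergent series below. *)
Local Notation "\sum_ ( m <= i '<oo' ) F" :=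
  (\big[+%R/0%R]_(m <= i <oo) F) : ring_scope.

(* [Bar k] stands for the barred index written as k with an overline. *)
Inductive eindex := Plain of nat | Bar of nat.

Definition index_val (e : eindex) : nat :=
  match e with Plain k => k | Bar k => k end.

Definition harmonic_sum (R : realType) (e : eindex) (n : nat) : R :=
  match e with
  | Plain p => \sum_(1 <= k < n.+1) k%:R ^- p
  | Bar p => \sum_(1 <= k < n.+1) (-1) ^+ k.-1 * k%:R ^- p
  end.

Definition Rsum (R : realType) (r : nat) (e : 'I_r -> eindex) (f : eindex) : R :=
  match f with
  | Plain q => \sum_(0 <= n <oo)
      (\prod_(j < r) harmonic_sum R (e j) n) / (n%:R + 2^-1) ^+ q
  | Bar q => \sum_(0 <= n <oo)
      (\prod_(j < r) harmonic_sum R (e j) n) / (n%:R + 2^-1) ^+ q * (-1) ^+ n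
  end.

(* Unlike in [harmonic_sum] and [Rsum], the sign in the barred single values is
   (-1)^n with n starting from 1. *)
Definition zeta_value (R : realType) (e : eindex) : R :=
  match e with
  | Plain k => \sum_(1 <= n <oo) (n%:R : R) ^- k
  | Bar k => \sum_(1 <= n <oo) (-1) ^+ n * (n%:R : R) ^- k
  end.

Definition R_value (R : realType) (e : eindex) : R :=
  match e with
  | Plain 1%N => 2 * ln 2
  | Plain k => \sum_(1 <= n <oo) (n%:R - 2^-1 : R) ^- k
  | Bar k => \sum_(1 <= n <oo) (-1) ^+ n * (n%:R - 2^-1 : R) ^- k
  end.

Inductive lower_order_value (R : realType) (r : nat) : R -> Prop :=
| LowerRsum (s : nat) (e : 'I_s -> eindex) (f : eindex) :
    (s < r)%N -> (forall j, (0 < index_val (e j))%N) -> (1 < index_val f)%N ->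
    lower_order_value r (Rsum R e f)
| LowerZeta (k : nat) : (1 < k)%N ->
    lower_order_value r (zeta_value R (Plain k))
| LowerZetaBar (k : nat) : (0 < k)%N ->
    lower_order_value r (zeta_value R (Bar k))
| LowerR (k : nat) : (0 < k)%N ->
    lower_order_value r (R_value R (Plain k))
| LowerRBar (k : nat) : (0 < k)%N ->
    lower_order_value r (R_value R (Bar k)).

Definition reduces_to_lower_orders (R : realType) (r : nat) (x : R) : Prop :=
  exists (m : nat) (P : mpoly.mpoly m rat) (v : 'I_m -> R),
    (forall i, lower_order_value r (v i)) /\
    x = mpoly.meval v (mpoly.map_mpoly (@ratr R) P).

(* Main.v *)
Require Import Defs.
From HB Require Import structures.
From mathcomp Require Import all_boot all_order all_algebra.
From mathcomp Require Import all_classical all_reals all_analysis.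
From mathcomp Require Import -(notations) mpoly.
From mathcomp Require Import ring lra zify.
Set Implicit Arguments.
Unset Strict Implicit.
Unset Printing Implicit Defensive.
Import Order.TTheory GRing.Theory Num.Theory.
Import numFieldNormedType.Exports.
Local Open Scope ring_scope.

(** The proof is a discrete form of the contour integration of Flajolet and
Salvy. Put T_i(n) = sum_(1 <= k <= n) eps_i^k k^(-p_i), which is the harmonic
sum X_n up to a sign, and let eps = 1 in case (i) and eps = -1 in case (ii).
For each N, take the rational function of s
  f_N(s) = K(s) * prod_i Y_i(s) * (s + 1/2)^(-q),
where K has simple poles of residue eps_0^n at the integers n from -N-1 to N,
where Y_i(s) = sum_(0 <= k <= N) eps_i^k (s - k)^(-p_i) + c_i, and where eps_0
is chosen so that eps_0 * prod_i eps_i = eps. It decreases at least as fast as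
s^(-2) at infinity, so that the sum of its residues vanishes
([sum_residues]). This identity is passed to the limit as N grows.

- At a nonnegative integer n, the regular part of Y_i takes, in the limit and
  up to the factor eps_i^n, the value T_i(n) plus a constant. Hence the residue
  is eps^n (n + 1/2)^(-q) prod_i T_i(n), plus terms in which some of the Y_i
  contribute a constant or their polar part instead of T_i(n). These terms
  are polynomials in harmonic sums of degree less than r, with reducible
  coefficients ([summand_nat]).
- At -n-1, only K has a pole. Reflection gives the same main term up to the
  sign eps (-1)^q prod_i (-1)^(p_i + 1), and the parity hypothesis says that
  this sign is 1 ([summand_neg]).
- At -1/2, the residue is a polynomial in Taylor coefficients of K and of the
  Y_i, which converge to zeta and R values ([summand_half]).

The main terms thus add up instead of cancelling, and twice the R-sum is
reducible ([bilateral_sum_red]).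

Two devices carry this out. Residues are computed in truncated power series:
the Laurent expansion at c of a product of D simple fractions 1 / (s - a),
multiplied by the D-th power of the local parameter X, is the product of the
polynomials [local_factor M (c - a)] modulo X^(M+1), and the residue is its
coefficient of index D - 1. The residue theorem follows from the partial
fraction identity for two poles ([residue_sum]). The passage to the limit is
Tannery's theorem ([tannery]): up to a constant factor, the residues at n and
-n-1 are dominated by a power of 1 + H_n divided by (n + 1)^2, where H_n is
the n-th harmonic number, uniformly in N. The only
divergence comes from the harmonic series itself; the constant c_i is the N-th
harmonic number when p_i = 1 and eps_i = 1, and 0 otherwise, and it is
responsible for the value R(1) = 2 log 2. *)

(** * The ring of reducible numbers *)

Section ReducibleNumbers.
Variables (R : realType) (r : nat).
Local Notation red := (@reduces_to_lower_orders R r).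

(** Renaming of variables, used to evaluate two polynomials on a common
tuple of values. *)
Local Definition lift_mpoly (m n : nat) (f : 'I_m -> 'I_n) (P : mpoly m rat) :
    mpoly n rat :=
  comp_mpoly [tuple mpolyX rat (mnm1 (f i)) | i < m] P.

Local Lemma lift_mpolyE (m n : nat) (f : 'I_m -> 'I_n) (v : 'I_n -> R) P :
  meval v (map_mpoly (@ratr R) (lift_mpoly f P)) =
  meval (v \o f) (map_mpoly (@ratr R) P).
Proof.
rewrite /lift_mpoly comp_mpolyEX [in RHS](mpolyE P).
rewrite !(raddf_sum (map_mpoly (@ratr R))) !(raddf_sum (meval _)) /=.
apply: eq_bigr => k _.
rewrite !map_mpolyZ !mevalZ map_mpolyX mevalX; congr (_ * _).
rewrite comp_mpolyX !rmorph_prod; apply: eq_bigr => i _.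
by rewrite !rmorphXn tnth_mktuple /= map_mpolyX mevalXU.
Qed.

Lemma red_rat (a : rat) : red (ratr a).
Proof.
exists 0%N, (mpolyC _ a), (fun=> 0); split; first by case.
by rewrite map_mpolyC mevalC.
Qed.

Lemma red_value x : lower_order_value r x -> red x.
Proof.
move=> hx; exists 1%N, (mpolyX rat (mnm1 ord0)), (fun=> x); split => //.
by rewrite map_mpolyX mevalXU.
Qed.

Local Definition joinv (m n : nat) (v : 'I_m -> R) (w : 'I_n -> R) (i : 'I_(m + n)) : R :=
  match fintype.split i with inl j => v j | inr j => w j end.

Local Lemma red2 x y : red x -> red y -> exists (m : nat) (v : 'I_m -> R) (P Q : mpoly m rat),
  [/\ forall i, lower_order_value r (v i),
      x = meval v (map_mpoly (@ratr R) P) &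
      y = meval v (map_mpoly (@ratr R) Q)].
Proof.
move=> [m [P [v [hv ->]]]] [n [Q [w [hw ->]]]].
exists (m + n)%N, (joinv v w), (lift_mpoly (@lshift m n) P), (lift_mpoly (@rshift m n) Q).
split; first by move=> i; rewrite /joinv; case: fintype.split.
- rewrite lift_mpolyE; apply: meval_eq => i /=.
  by rewrite /joinv (unsplitK (inl _ i)).
- rewrite lift_mpolyE; apply: meval_eq => i /=.
  by rewrite /joinv (unsplitK (inr _ i)).
Qed.

Lemma redD x y : red x -> red y -> red (x + y).
Proof.
move=> hx hy; have [m [v [P [Q [hv -> ->]]]]] := red2 hx hy.
by exists m, (P + Q), v; split => //; rewrite !raddfD.
Qed.

Lemma redM x y : red x -> red y -> red (x * y).
Proof.
move=> hx hy; have [m [v [P [Q [hv -> ->]]]]] := red2 hx hy.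
by exists m, (P * Q), v; split => //; rewrite !rmorphM.
Qed.

Lemma red0 : red 0. Proof. by rewrite -(rmorph0 (@ratr R)); exact: red_rat. Qed.
Lemma red1 : red 1. Proof. by rewrite -(rmorph1 (@ratr R)); exact: red_rat. Qed.
Lemma redN x : red x -> red (- x).
Proof.
move=> hx; rewrite -mulN1r; apply: redM => //.
by rewrite -(rmorph1 (@ratr R)) -rmorphN; exact: red_rat.
Qed.
Lemma redX x n : red x -> red (x ^+ n).
Proof.
by move=> hx; elim: n => [|n IH]; rewrite ?expr0 ?exprS; [exact: red1|exact: redM].
Qed.
Lemma red_sign (b : bool) n : red ((-1) ^+ b ^+ n).
Proof. by do 2!apply: redX; apply: redN; exact: red1. Qed.
Lemma red_half : red 2^-1.
Proof. by have := red_rat 2^-1; rewrite fmorphV rmorph_nat. Qed.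
Lemma red_sum I (s : seq I) (P : pred I) F :
  (forall i, P i -> red (F i)) -> red (\sum_(i <- s | P i) F i).
Proof. by move=> h; apply: (big_ind red) => //; [exact: red0|exact: redD]. Qed.

(** Polynomials with reducible coefficients form a ring; the local expansions
below have such coefficients. *)
Lemma red_coefM (P Q : {poly R}) :
  (forall i, red P`_i) -> (forall i, red Q`_i) -> forall i, red (P * Q)`_i.
Proof. by move=> hP hQ i; rewrite coefM; apply: red_sum => j _; exact: redM. Qed.
Lemma red_coefX (P : {poly R}) n :
  (forall i, red P`_i) -> forall i, red (P ^+ n)`_i.
Proof.
move=> hP; elim: n => [|n IH] i; last by rewrite exprS; exact: red_coefM.
by rewrite expr0 coef1; case: eqP => _; [exact: red1|exact: red0].
Qed.
End ReducibleNumbers.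

(** * Limits of sequences *)

Section Limits.
Variable R : realType.
Implicit Types (u v f b : nat -> R) (l : R).

(** Convergence of a sequence, as a predicate on plain functions so that the
algebra of limits applies to lambda abstractions. *)
Definition tends u l : Prop := (u @ \oo --> l)%classic.

Lemma tendsP u l : tends u l <->
  forall eps, 0 < eps -> exists N0, forall n, (N0 <= n)%N -> `|u n - l| < eps.
Proof.
split=> [/cvgrPdist_lt h eps /h [N0 _ hN0]|h].
  by exists N0 => n /hN0 /=; rewrite distrC.
apply/cvgrPdist_lt => eps /h[N0 hN0]; exists N0 => // n /hN0 /=.
by rewrite distrC.
Qed.

Lemma tends_cst l : tends (fun=> l) l. Proof. exact: cvg_cst. Qed.
Lemma tendsD u v l m : tends u l -> tends v m -> tends (fun n => u n + v n) (l + m).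
Proof. exact: cvgD. Qed.
Lemma tendsM u v l m : tends u l -> tends v m -> tends (fun n => u n * v n) (l * m).
Proof. exact: cvgM. Qed.
Lemma tendsN u l : tends u l -> tends (fun n => - u n) (- l).
Proof. exact: cvgN. Qed.
Lemma tendsB u v l m : tends u l -> tends v m -> tends (fun n => u n - v n) (l - m).
Proof. exact: cvgB. Qed.
Lemma tends_sum I (s : seq I) (F : I -> nat -> R) L :
  (forall i, tends (F i) (L i)) ->
  tends (fun n => \sum_(i <- s) F i n) (\sum_(i <- s) L i).
Proof.
move=> h; elim: s => [|i s IH].
  by rewrite big_nil (_ : (fun=> _) = fun=> 0); [exact: tends_cst|apply/funext => n; rewrite big_nil].
rewrite big_cons (_ : (fun=> _) = fun n => F i n + \sum_(j <- s) F j n).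
  exact: tendsD.
by apply/funext => n; rewrite big_cons.
Qed.
Lemma tends_prod I (s : seq I) (F : I -> nat -> R) L :
  (forall i, tends (F i) (L i)) ->
  tends (fun n => \prod_(i <- s) F i n) (\prod_(i <- s) L i).
Proof.
move=> h; elim: s => [|i s IH].
  by rewrite big_nil (_ : (fun=> _) = fun=> 1); [exact: tends_cst|apply/funext => n; rewrite big_nil].
rewrite big_cons (_ : (fun=> _) = fun n => F i n * \prod_(j <- s) F j n).
  exact: tendsM.
by apply/funext => n; rewrite big_cons.
Qed.
Lemma tends_uniq u l m : tends u l -> tends u m -> l = m.
Proof. by move=> h1 h2; apply: cvg_unique h1 h2. Qed.
Lemma tends_lim u l : tends u l -> limn u = l.
Proof. by move=> h; apply: cvg_lim. Qed.
Lemma tendsS u l : tends (fun n => u n.+1) l <-> tends u l.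
Proof. by rewrite /tends cvg_shiftS. Qed.
Lemma tends_near u v l N0 : tends u l -> (forall n, (N0 <= n)%N -> u n = v n) -> tends v l.
Proof.
move=> /tendsP h e; apply/tendsP => eps /h [N1 h1]; exists (maxn N0 N1) => n.
by rewrite geq_max => /andP[/e <- /h1].
Qed.
Lemma tends_squeeze u v l N0 :
  (forall n, (N0 <= n)%N -> `|u n - l| <= v n) -> tends v 0 -> tends u l.
Proof.
move=> h /tendsP hv; apply/tendsP => eps /hv [N1 h1].
exists (maxn N0 N1) => n; rewrite geq_max => /andP[/h + /h1]; rewrite subr0.
by move=> h2 h3; apply: (le_lt_trans h2 (le_lt_trans (ler_norm _) h3)).
Qed.
Lemma tends_norm_le u l B N0 :
  (forall n, (N0 <= n)%N -> `|u n| <= B) -> tends u l -> `|l| <= B.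
Proof.
move=> h hu; apply: (@cvgr_to_le nat \oo%classic _ _ (fun n => `|u n|)).
  exact: cvg_norm.
by exists N0.
Qed.
Lemma tends_bounded u l : tends u l -> exists B, 0 <= B /\ forall n, `|u n| <= B.
Proof.
move=> h; have /cvg_has_ub [B hB] : cvgn u by apply/cvg_ex; exists l.
by exists B; split=> [|n]; [apply: le_trans (normr_ge0 (u 0%N)) _|]; apply: hB; exists 0%N + exists n.
Qed.
Lemma tends_inv_add (c : R) : tends (fun n => c / (n.+1)%:R) 0.
Proof.
rewrite -[X in tends _ X](mulr0 c); apply: tendsM; first exact: tends_cst.
exact: cvg_harmonic.
Qed.

Lemma nondecreasing_tends_le u l n : {homo u : m n / (m <= n)%N >-> m <= n} ->
  tends u l -> u n <= l.
Proof.
move=> hu h; rewrite -(tends_lim h); apply: nondecreasing_cvgn_le => //.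
by apply/cvg_ex; exists l.
Qed.

(** The upper bound is included, to match the ranges 0..N of poles. *)
Definition psum u n := \sum_(0 <= k < n.+1) u k.

Lemma psumS u n : psum u n.+1 = psum u n + u n.+1.
Proof. by rewrite /psum big_nat_recr. Qed.

Lemma psum_series u l : tends (psum u) l <-> tends (series u) l.
Proof. exact: (tendsS (series u)). Qed.

Lemma psum_dominated f b : (forall n, `|f n| <= b n) ->
  (exists l, tends (psum b) l) -> exists l, tends (psum f) l.
Proof.
move=> hb [l /psum_series hl].
suff /cvg_ex[m hm] : cvgn (series f) by exists m; apply/psum_series.
apply: normed_cvg; apply: (@series_le_cvg _ _ b) => [n|n|n|].
- exact: normr_ge0.
- exact: le_trans (hb n).
- exact: hb.
by apply/cvg_ex; exists l.
Qed.

(** The tail of the sum of a N - f is at most twice the tail of the sum of b,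
whatever N is, and each of the remaining finitely many terms tends to 0. *)
Lemma tannery (a : nat -> nat -> R) f b :
  (forall N n, (n <= N)%N -> `|a N n| <= b n) ->
  (exists l, tends (psum b) l) -> (forall n, tends (a^~ n) (f n)) ->
  exists l, tends (psum f) l /\ tends (fun N => psum (a N) N) l.
Proof.
move=> hab hb haf.
have hfb n : `|f n| <= b n by apply: (tends_norm_le (N0 := n)) (haf n) => N; exact: hab.
have [l hl] := psum_dominated hfb hb; exists l; split => //.
have b0 n : 0 <= b n by apply: le_trans (hfb n).
have [B hB] := hb.
have mono : {homo psum b : m n / (m <= n)%N >-> m <= n}.
  by apply/nondecreasing_seqP => n; rewrite psumS lerDl.
suff h0 : tends (fun N => psum (fun n => a N n - f n) N) 0.
  rewrite -[l]add0r; have := tendsD h0 hl; congr (tends _ _); apply/funext => N.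
  by rewrite /psum -big_split; apply: eq_bigr => k _ /=; rewrite subrK.
apply/tendsP => eps eps0.
have [M /(_ M (leqnn _)) hM] := (tendsP _ _).1 hB (eps / 4) ltac:(lra).
have h1 : tends (fun N => psum (fun n => `|a N n - f n|) M) 0.
  rewrite -[X in tends _ X](@big1 _ 0 +%R _ (index_iota 0 M.+1) xpredT (fun=> 0)) //.
  apply: tends_sum => n; rewrite -[X in tends _ X](normr0 R).
  apply: cvg_norm; rewrite -(subrr (f n)); apply: (@tendsB _ (fun=> f n)); [exact: haf|exact: tends_cst].
have [N1 hN1] := (tendsP _ _).1 h1 (eps / 2) ltac:(lra).
exists (maxn M N1) => N; rewrite geq_max => /andP[MN /hN1]; rewrite !subr0 => h2.
apply: le_lt_trans (ler_norm_sum _ _ _) _.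
rewrite (big_cat_nat _ (n := M.+1)) //=.
have h3 : \sum_(M.+1 <= k < N.+1) `|a N k - f k| <= 2 * (psum b N - psum b M).
  have -> : psum b N - psum b M = \sum_(M.+1 <= k < N.+1) b k.
    by apply/eqP; rewrite subr_eq addrC /psum -big_cat_nat.
  rewrite mulr_sumr.
  rewrite !big_nat; apply: ler_sum => k /andP[_ hk].
  apply: le_trans (ler_normB _ _) _; have := hab N k hk; have := hfb k; lra.
have h4 := nondecreasing_tends_le N mono hB.
have h5 : psum (fun n => `|a N n - f n|) M < eps / 2.
  exact: le_lt_trans (ler_norm _) h2.
rewrite -/(psum (fun n => `|a N n - f n|) M).
move: hM; rewrite ltr_norml => /andP[hM _]; lra.
Qed.

(** Averaging the sum with its shift turns the terms a_k into the differences
a_k - a_(k+1), whose sum telescopes, hence converges absolutely. *)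
Lemma alternating_tends (a : nat -> R) :
  (forall n, 0 <= a n.+1 <= a n) -> tends a 0 ->
  exists l, tends (psum (fun k => (-1) ^+ k * a k)) l.
Proof.
move=> ha a0.
have [l hl] : exists l, tends (psum (fun k => (-1) ^+ k * (a k - a k.+1))) l.
  apply: (psum_dominated (b := fun k => a k - a k.+1)).
    by move=> n; rewrite normrM normrX normrN1 expr1n mul1r ger0_norm ?subr_ge0//; case/andP: (ha n).
  exists (a 0%N - 0).
  rewrite (_ : psum _ = fun n => a 0%N - a n.+1); last first.
    apply/funext => n; elim: n => [|n IH]; first by rewrite /psum big_nat1.
    by rewrite psumS IH; ring.
  by apply: tendsB; [exact: tends_cst|apply/tendsS].
(* 2 S = a_0 + (the sum of the differences) + a boundary term tending to 0. *)
exists (2^-1 * (a 0%N - 0 + l)).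
rewrite (_ : psum _ = fun n => 2^-1 * (a 0%N - (-1) ^+ n.+1 * a n.+1 +
     psum (fun k => (-1) ^+ k * (a k - a k.+1)) n)).
  apply: tendsM; first exact: tends_cst.
  apply: tendsD hl; apply: tendsB; first exact: tends_cst.
  apply: (@tends_squeeze _ (fun n => a n.+1) _ 0); last by apply/tendsS.
  move=> n _; rewrite subr0 normrM normrX normrN1 expr1n mul1r ger0_norm //.
  by case/andP: (ha n).
apply/funext => n; elim: n => [|n IH]; first by rewrite /psum !big_nat1 expr0 expr1; field.
by rewrite !psumS IH (exprS _ n.+1); field.
Qed.

End Limits.

(** * Growth of the harmonic numbers *)

Section HarmonicGrowth.
Variable R : realType.

Definition harm n : R := \sum_(1 <= k < n.+1) (k%:R)^-1.
Lemma harm0 : harm 0 = 0. Proof. by rewrite /harm big_geq. Qed.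
Lemma harmS n : harm n.+1 = harm n + (n.+1%:R)^-1.
Proof. by rewrite /harm big_nat_recr. Qed.
Lemma harm_ge0 n : 0 <= harm n.
Proof. by apply: sumr_ge0 => k _; rewrite invr_ge0 ler0n. Qed.

(** A mean value inequality for powers; it bounds the increments that summation
by parts produces in [logw_bounded]. *)
Lemma exprD_le (x h : R) m : 1 <= x -> 0 <= h ->
  (x + h) ^+ m.+1 <= x ^+ m.+1 + m.+1%:R * h * (x + h) ^+ m.
Proof.
move=> x1 h0.
elim: m => [|m IH]; first by rewrite !expr1 expr0; lra.
rewrite exprS (exprS x).
have h1 : (x + h) * (x + h) ^+ m.+1 = x * (x + h) ^+ m.+1 + h * (x + h) ^+ m.+1 by ring.
have h2 : x * (x + h) ^+ m.+1 <= x * x ^+ m.+1 + m.+1%:R * h * (x * (x + h) ^+ m).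
  by have := ler_wpM2l (_ : 0 <= x) IH; rewrite mulrDr; move=> /(_ ltac:(lra)); lra.
have h3 : x * (x + h) ^+ m <= (x + h) ^+ m.+1.
  by rewrite exprS ler_wpM2r ?exprn_ge0; lra.
have h4 : 0 <= m.+1%:R * h by rewrite mulr_ge0.
have := ler_wpM2l h4 h3; rewrite h1 -(natr1 m.+1); lra.
Qed.

(** Weights dominating the residues. The inverse of the denominator is
1 / (n + 1) - 1 / (n + 2), which makes summation by parts immediate. *)
Definition logw m n : R := (1 + harm n) ^+ m / (n.+1%:R * n.+2%:R).
Lemma logw_ge0 m n : 0 <= logw m n.
Proof.
rewrite /logw divr_ge0 ?mulr_ge0 ?exprn_ge0 //; have := harm_ge0 n; lra.
Qed.

(** Induction on the power m. Summation by parts against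
1 / (n + 1) - 1 / (n + 2) replaces the m.+1-th power of 1 + H_n with its
increment, which is of the order of the m-th power divided by n. *)
Lemma logw_bounded m : exists C, forall N, psum (logw m) N <= C.
Proof.
elim: m => [|m [C hC]].
  exists 1 => N; suff -> : psum (logw 0) N = 1 - (N.+2%:R)^-1.
    by rewrite gerBl invr_ge0.
  elim: N => [|N IH].
    by rewrite /psum big_nat1 /logw expr0; field.
  rewrite psumS IH /logw expr0; field.
  by rewrite -?natrD ?nat1r ?pnatr_eq0.
exists (1 + 3 * m.+1%:R * C) => N.
suff h : psum (logw m.+1) N + (1 + harm N) ^+ m.+1 / N.+2%:R <= 1 + 3 * m.+1%:R * psum (logw m) N.
  have h1 : 0 <= (1 + harm N) ^+ m.+1 / N.+2%:R.
    by rewrite divr_ge0 ?exprn_ge0 //; have := harm_ge0 N; lra.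
  have h2 : 3 * m.+1%:R * psum (logw m) N <= 3 * m.+1%:R * C.
    by rewrite ler_wpM2l ?mulr_ge0.
  apply: le_trans (_ : 1 + 3 * m.+1%:R * psum (logw m) N <= _); last by rewrite lerD2l.
  by apply: le_trans h; rewrite lerDl.
elim: N => [|N IH].
  rewrite /psum !big_nat1 /logw harm0 !addr0 !expr1n !mul1r.
  have : 0 <= m.+1%:R :> R by []. lra.
have hN := harm_ge0 N.
rewrite !psumS harmS.
have := @exprD_le (1 + harm N) (N.+1%:R^-1) m ltac:(lra) ltac:(by []).
rewrite -addrA => h.
set A := (1 + _) ^+ m.+1 in h IH; set B := (1 + _) ^+ m.+1 in h *.
set D := (1 + _) ^+ m in h.
have e1 : logw m.+1 N.+1 = B / (N.+2%:R * N.+3%:R) by rewrite /logw harmS.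
have e2 : logw m N.+1 = D / (N.+2%:R * N.+3%:R) by rewrite /logw harmS.
have e3 : logw m.+1 N.+1 + B / N.+3%:R = B / N.+2%:R.
  by rewrite e1; field; rewrite -?natrD ?nat1r ?pnatr_eq0.
have D0 : 0 <= D by rewrite exprn_ge0 // !addr_ge0.
have e4 : B / N.+2%:R <= A / N.+2%:R + m.+1%:R * (D / (N.+1%:R * N.+2%:R)).
  rewrite [X in _ <= _ + X](_ : _ = (m.+1%:R * (N.+1)%:R^-1 * D) / N.+2%:R).
    by rewrite -mulrDl ler_wpM2r.
  by field; rewrite -?natrD ?nat1r ?pnatr_eq0.
(* The constant 3 absorbs the shift of the denominator: N + 3 <= 3 (N + 1). *)
have e5 : D / (N.+1%:R * N.+2%:R) <= 3 * logw m N.+1.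
  rewrite e2 mulrCA ler_wpM2l //.
  rewrite ler_pdivlMr ?mulr_gt0 // mulrC ler_pdivrMr ?mulr_gt0 //.
  rewrite -(natr1 N.+2) -(natr1 N.+1) -(natr1 N).
  have : 0 <= N%:R :> R by []. nra.
have e6 : m.+1%:R * (D / (N.+1%:R * N.+2%:R)) <= m.+1%:R * (3 * logw m N.+1).
  by rewrite ler_wpM2l.
rewrite -(addrA (psum _ N)) e3 mulrDr (addrA 1).
apply: le_trans (_ : psum (logw m.+1) N + A / N.+2%:R + m.+1%:R * (3 * logw m N.+1) <= _).
  by rewrite -addrA lerD2l; apply: le_trans e4 _; rewrite lerD2l.
by rewrite lerD // mulrCA mulrA.
Qed.

Lemma logw_tends m : exists l, tends (psum (logw m)) l.
Proof.
have [C hC] := logw_bounded m.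
suff /cvg_ex[l hl] : cvgn (psum (logw m)) by exists l.
apply: nondecreasing_is_cvgn; last by exists C => _ [n _ <-].
by apply/nondecreasing_seqP => n; rewrite psumS lerDl logw_ge0.
Qed.
End HarmonicGrowth.

(** * Zeta and R values as limits *)

Section ConstantLimits.
Variable R : realType.

(** The character n |-> 1 or (-1)^n attached to a plain or barred index. *)
Definition sgn (b : bool) : R := (-1) ^+ b.
Lemma sgn_mul b k : sgn b ^+ k * sgn b ^+ k = 1.
Proof. by rewrite -exprMn -expr2 /sgn sqrr_sign expr1n. Qed.
Lemma norm_sgn b k : `|sgn b ^+ k| = 1.
Proof. by rewrite /sgn -exprM normrX normrN1 expr1n. Qed.

Definition signed_sum (b : bool) P n : R := \sum_(1 <= k < n.+1) sgn b ^+ k * k%:R ^- P.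
Local Notation T := signed_sum.
Definition half_sum (b : bool) P n : R := \sum_(0 <= k < n.+1) sgn b ^+ k * (k%:R + 2^-1) ^- P.

Lemma signed_sumS b P n : T b P n.+1 = T b P n + sgn b ^+ n.+1 * n.+1%:R ^- P.
Proof. by rewrite /T big_nat_recr. Qed.
Lemma signed_sum0 b P : T b P 0 = 0. Proof. by rewrite /T big_geq. Qed.

Lemma harmE n : harm R n = T false 1 n.
Proof. by apply: eq_bigr => k _; rewrite /sgn expr0 expr1n mul1r expr1. Qed.

Lemma norm_term_le b P k : (0 < P)%N -> `|sgn b ^+ k.+1 * k.+1%:R ^- P| <= (k.+1%:R : R)^-1.
Proof.
case: P => // P _; rewrite normrM norm_sgn mul1r ger0_norm ?invr_ge0 ?exprn_ge0 //.
rewrite lef_pV2 ?posrE ?exprn_gt0 // exprS ler_peMr //.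
by rewrite exprn_ege1 // ler1n.
Qed.

(** This bound depends only on the length k of the range, hence is uniform in
m: it provides the domination in Tannery's theorem, while
[signed_sum_diff_div] provides the pointwise limit. *)
Lemma signed_sum_diff_harm b P m k : (0 < P)%N -> `|T b P (m + k) - T b P m| <= harm R k.
Proof.
move=> P0; elim: k => [|k IH]; first by rewrite addn0 subrr normr0 harm0.
rewrite addnS signed_sumS harmS addrAC; apply: le_trans (ler_normD _ _) _.
apply: lerD IH _; apply: le_trans (norm_term_le _ _ P0) _.
by rewrite lef_pV2 ?posrE // ler_nat ltnS leq_addl.
Qed.

Lemma signed_sum_diff_div b P m k : (0 < P)%N -> `|T b P (m + k) - T b P m| <= k%:R / m.+1%:R.
Proof.
move=> P0; elim: k => [|k IH]; first by rewrite addn0 subrr normr0 mul0r.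
rewrite addnS signed_sumS addrAC; apply: le_trans (ler_normD _ _) _.
rewrite -(natr1 k) mulrDl mul1r; apply: lerD IH _; apply: le_trans (norm_term_le _ _ P0) _.
by rewrite lef_pV2 ?posrE // ler_nat ltnS leq_addr.
Qed.

Lemma signed_sum_backshift b P n : (0 < P)%N -> tends (fun N => T b P (N - n) - T b P N) 0.
Proof.
move=> P0; apply: (@tends_near _ (fun N => - (T b P N - T b P (N - n))) _ _ 0); last first.
  by move=> N _; rewrite opprB.
rewrite -oppr0; apply: tendsN.
have h : tends (fun N => T b P (N + n) - T b P N) 0.
  apply: (@tends_squeeze _ _ (fun N => n%:R / N.+1%:R) _ 0); last exact: tends_inv_add.
  by move=> N _; rewrite subr0; exact: signed_sum_diff_div.
apply/tendsP => eps /((tendsP _ _).1 h)[N0 h0]; exists (N0 + n)%N => N hN.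
have /h0 : (N0 <= N - n)%N by lia.
by rewrite subnK //; lia.
Qed.

Lemma signed_sum_foreshift b P n : (0 < P)%N -> tends (fun N => T b P (N + n) - T b P N) 0.
Proof.
move=> P0; apply: (@tends_squeeze _ _ (fun N => n%:R / N.+1%:R) _ 0); last exact: tends_inv_add.
by move=> N _; rewrite subr0; exact: signed_sum_diff_div.
Qed.

(** Absolute convergence is obtained by comparison with the weights [logw];
here x is n + 1 for zeta values and n + 1/2 for R-sums. *)
Lemma inv_pow_le (x : R) n P m : n.+1%:R / 2 <= x -> (1 < P)%N ->
  (1 + harm R n) ^+ m * x ^- P <= 2 ^+ P * 2 * logw R m n.
Proof.
move=> hx; case: P => [|[|P]] // _.
have h1 : x ^- P.+2 <= 2 ^+ P.+2 * n.+1%:R ^- 2.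
  have h2 : (n.+1%:R / 2) ^+ P.+2 <= x ^+ P.+2 by rewrite lerXn2r ?nnegrE ?divr_ge0 //; apply: le_trans hx.
  have h3 : 0 < (n.+1%:R / 2 : R) by rewrite divr_gt0.
  apply: (@le_trans _ _ ((n.+1%:R / 2) ^- P.+2)).
    by rewrite lef_pV2 ?posrE // exprn_gt0 //; exact: lt_le_trans hx.
  rewrite expr_div_n invf_div ler_wpM2l ?exprn_ge0 //.
  rewrite lef_pV2 ?posrE ?exprn_gt0 //.
  by rewrite ler_weXn2l // ler1n.
have h2 : (n.+1%:R : R) ^- 2 <= 2 / (n.+1%:R * n.+2%:R).
  rewrite ler_pdivlMr ?mulr_gt0 // mulrC ler_pdivrMr ?exprn_gt0 //.
  rewrite expr2 -(natr1 n.+1) -(natr1 n).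
  have : 0 <= n%:R :> R by []. nra.
rewrite /logw.
rewrite [X in _ <= X](_ : _ = (1 + harm R n) ^+ m * (2 ^+ P.+2 * (2 / (n.+1%:R * n.+2%:R)))).
  rewrite ler_wpM2l ?exprn_ge0 ?addr_ge0 ?harm_ge0 //.
  by apply: le_trans h1 _; rewrite ler_wpM2l // exprn_ge0.
by rewrite [LHS]mulrCA -(mulrA (2 ^+ _)).
Qed.

Lemma tends_scaled_logw m (C : R) : exists l, tends (psum (fun n => C * logw R m n)) l.
Proof.
have [l hl] := logw_tends R m; exists (C * l).
rewrite (_ : psum _ = fun n => C * psum (logw R m) n).
  by apply: tendsM => //; exact: tends_cst.
by apply/funext => n; rewrite /psum mulr_sumr.
Qed.

(** Absolute convergence when P > 1, alternating series when P = 1. *)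
Lemma signed_powers_tends b P (x : nat -> R) : (0 < P)%N -> (b || (1 < P)%N) ->
  (forall n, n.+1%:R / 2 <= x n <= x n.+1) ->
  exists l, tends (psum (fun k => sgn b ^+ k * x k ^- P)) l.
Proof.
move=> P0 hP hx.
have x0 n : 0 < x n by case/andP: (hx n) => h _; apply: lt_le_trans h; rewrite divr_gt0.
have [P1|P1] := boolP (1 < P)%N.
  apply: (psum_dominated (b := fun n => 2 ^+ P * 2 * logw R 0 n)); last exact: tends_scaled_logw.
  move=> n; rewrite normrM norm_sgn mul1r gtr0_norm ?invr_gt0 ?exprn_gt0 //.
  have := @inv_pow_le (x n) n P 0; rewrite expr0 mul1r => h.
  by apply: h => //; case/andP: (hx n).
have eP : P = 1%N by move: P0 P1; clear; case: P => [|[|]].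
rewrite eP; case: b hP => [_|]; last by rewrite (negPf P1).
apply: alternating_tends => [n|].
  rewrite !expr1 invr_ge0 (ltW (x0 _)) /= lef_pV2 ?posrE //.
  by case/andP: (hx n).
apply: (@tends_squeeze _ _ (fun n => 2 / n.+1%:R) _ 0); last exact: tends_inv_add.
move=> n _; rewrite subr0 expr1 gtr0_norm ?invr_gt0 //.
by rewrite -[X in X <= _]div1r ler_pdivrMr // mulrC mulrA ler_pdivlMr //; case/andP: (hx n); lra.
Qed.

Lemma lim_sum1 (F : nat -> R) l :
  tends (fun n => \sum_(1 <= k < n.+1) F k) l -> \big[+%R/0]_(1 <= k <oo) F k = l.
Proof. by move=> h; apply: tends_lim; exact: (tendsS (fun n => \sum_(1 <= k < n) F k) l).1. Qed.

Lemma signed_sum_tends b P : (0 < P)%N -> (b || (1 < P)%N) ->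
  tends (T b P) (zeta_value R (if b then Bar P else Plain P)).
Proof.
move=> P0 hP.
have [l hl] : exists l, tends (T b P) l.
  have [n|l hl] := @signed_powers_tends b P (fun k => k.+1%:R) P0 hP.
    by rewrite ler_nat leqnSn andbT ler_pdivrMr // ler_peMr // ler1n.
  exists (sgn b * l); apply/tendsS.
  rewrite (_ : (fun n => _) = fun n => sgn b * psum (fun k => sgn b ^+ k * k.+1%:R ^- P) n).
    by apply: tendsM => //; exact: tends_cst.
  apply/funext => n; rewrite /T big_add1 /psum mulr_sumr /=.
  by apply: eq_bigr => k _; rewrite mulrA exprS.
suff -> : zeta_value R (if b then Bar P else Plain P) = l by [].
case: b hP hl => _ h; apply: lim_sum1; apply: (@tends_near _ _ _ _ 0 h) => n _.
  by apply: eq_bigr => k _.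
by apply: eq_bigr => k _; rewrite /sgn expr0 expr1n mul1r.
Qed.

Lemma half_sum_tends b P : (0 < P)%N -> (b || (1 < P)%N) ->
  tends (half_sum b P) (if b then - R_value R (Bar P) else R_value R (Plain P)).
Proof.
move=> P0 hP.
have [n|l hl] := @signed_powers_tends b P (fun k => k%:R + 2^-1) P0 hP.
  rewrite -natr1; have : 0 <= n%:R :> R by []. lra.
suff -> : (if b then - R_value R (Bar P) else R_value R (Plain P)) = l by exact: hl.
have sh n : \sum_(1 <= k < n.+2) sgn b ^+ k * (k%:R - 2^-1 : R) ^- P = sgn b * half_sum b P n.
  rewrite big_add1 /half_sum mulr_sumr /=; apply: eq_bigr => k _.
  rewrite exprS mulrA; congr (_ * _ ^- P); rewrite -natr1; lra.
case: b hP hl sh => hP hl sh.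
  apply/eqP; rewrite eqr_oppLR; apply/eqP; apply: lim_sum1; apply/tendsS.
  apply: (@tends_near _ _ _ _ 0 (tendsN hl)) => n _.
  by have := sh n; rewrite /sgn expr1 mulN1r => <-.
have -> : R_value R (Plain P) = \big[+%R/0]_(1 <= n <oo) (n%:R - 2^-1 : R) ^- P.
  by case: P P0 hP {hl sh} => [|[|P]].
apply: lim_sum1; apply/tendsS; apply: (@tends_near _ _ _ _ 0 hl) => n _.
rewrite -[LHS]mul1r -/(half_sum false P n) -[1]/(sgn false) -sh.
by apply: eq_bigr => k _; rewrite /sgn expr0 expr1n mul1r.
Qed.

(** Compare the logarithm with 1 / k on each interval [k, k + 1] from n + 1 to
2(n + 1). *)
Lemma ln2_bounds n : harm R (n.+1 + n.+1) - harm R n.+1 <= ln 2 <= harm R (n.+1 + n.+1) - harm R n.+1 + 1 / n.+1%:R.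
Proof.
have step (k : nat) : (k.+2%:R : R)^-1 <= ln (k.+2%:R : R) - ln k.+1%:R <= (k.+1%:R)^-1.
  have k1 : 0 < (k.+1%:R : R) by [].
  have k2 : 0 < (k.+2%:R : R) by [].
  rewrite -ln_div ?posrE //; apply/andP; split.
    have := @le_ln1Dx R (- (k.+2%:R)^-1).
    have -> : 1 + - (k.+2%:R)^-1 = (k.+2%:R / k.+1%:R)^-1 :> R.
      by rewrite -(natr1 k.+1); field; rewrite -?natrD ?nat1r ?natr1 ?pnatr_eq0.
    rewrite lnV ?posrE ?divr_gt0 // ltrN2 invf_lt1 // ltr1n => /(_ isT).
    by rewrite lerN2.
  have := @le_ln1Dx R (k.+1%:R)^-1.
  have -> : 1 + (k.+1%:R)^-1 = k.+2%:R / k.+1%:R :> R.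
    by rewrite -(natr1 k.+1); field; rewrite -?natrD ?nat1r ?natr1 ?pnatr_eq0.
  by apply; apply: lt_trans (ltrN10 _) _; rewrite invr_gt0.
have h j : harm R (n.+1 + j) - harm R n.+1 <= ln (n.+1 + j)%:R - ln n.+1%:R
      <= harm R (n.+1 + j) - harm R n.+1 + (n.+1%:R)^-1 - ((n.+1 + j)%:R)^-1.
  elim: j => [|j IH]; first by rewrite addn0 addrK !subrr lexx.
  rewrite addnS harmS; have := step (n + j)%N; rewrite addSn in IH *.
  move: IH; move: (_^-1) => a; move: (_^-1) => b; move: (_^-1) => c.
  by move=> /andP[? ?] /andP[? ?]; apply/andP; split; lra.
have := h n.+1.
have -> : (n.+1 + n.+1)%:R = 2 * n.+1%:R :> R by rewrite natrD; ring.
rewrite lnM ?posrE // div1r.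
have : 0 <= (2 * n.+1%:R)^-1 :> R by rewrite invr_ge0 mulr_ge0.
move: (_^-1) => a; move: (_^-1) => b.
by move=> ? /andP[? ?]; apply/andP; split; lra.
Qed.

Lemma half_sum1_harm N : half_sum false 1 N = 2 * harm R (N.+1 + N.+1) - harm R N.+1.
Proof.
elim: N => [|N IH].
  by rewrite /half_sum big_nat1 /sgn (_ : 1 + 1 = 2)%N // !harmS harm0; field.
rewrite /half_sum big_nat_recr //= -/(half_sum false 1 N) IH.
have -> : (N.+2 + N.+2 = (N.+1 + N.+1).+2)%N by lia.
rewrite (harmS _ (N.+1 + N.+1).+1) (harmS _ (N.+1 + N.+1)) (harmS _ N.+1).
rewrite /sgn expr0 expr1n mul1r expr1.
have -> : (N.+1 + N.+1).+2%:R = 2 * (N.+1%:R + 1) :> R.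
  by rewrite -!natr1 natrD -natr1; ring.
have -> : (N.+1 + N.+1).+1%:R = 2 * (N.+1%:R + 2^-1) :> R.
  by rewrite -!natr1 natrD -natr1; field.
rewrite -(natr1 N.+1).
have h0 : 0 <= N%:R :> R by [].
by field; repeat (apply/andP; split); apply: lt0r_neq0; lra.
Qed.

(** The regularized value at P = 1, where the series itself diverges: the sum
of the 2 / (2k + 1) exceeds H_N by 2 (H_(2N) - H_N) up to O(1 / N). *)
Lemma half_sum1_tends : tends (fun N => half_sum false 1 N - harm R N) (2 * ln 2).
Proof.
apply: (@tends_squeeze _ _ (fun n => 3 / n.+1%:R) _ 0); last exact: tends_inv_add.
move=> n _; rewrite half_sum1_harm.
have := ln2_bounds n; rewrite (harmS _ n).
have : 0 < (n.+1%:R)^-1 :> R by rewrite invr_gt0.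
by rewrite div1r ler_norml; move: (_^-1) => a ? /andP[? ?]; apply/andP; split; lra.
Qed.
End ConstantLimits.

(** * Residues of products of simple fractions *)

Section Residues.
Variable R : fieldType.
Implicit Types (x y a c : R) (F s : seq R).

(** The expansion of 1 / (x + X) modulo X^M. *)
Definition inv_series (M : nat) x : {poly R} :=
  (x^-1)%:P * \sum_(l < M) (- (x^-1)%:P * 'X) ^+ l.
(** X / (X + x) modulo X^(M+1), the expansion at c of the simple fraction
1 / (s - a) for x = c - a, multiplied by the local parameter X = s - c. At a
pole, where x = 0, this is exactly 1. *)
Definition local_factor (M : nat) x : {poly R} :=
  if x == 0 then 1 else 'X * inv_series M x.

Lemma local_factorM M x : exists h,
  local_factor M x * (x%:P + 'X) = 'X + 'X^(M.+1) * h.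
Proof.
rewrite /local_factor; case: eqP => [->|/eqP x0]; first by exists 0; rewrite mul1r add0r mulr0 addr0.
exists (- (- (x^-1)%:P) ^+ M).
have e : x%:P + 'X = x%:P * (1 - (- (x^-1)%:P * 'X)) :> {poly R}.
  rewrite mulrBr mulr1 mulNr mulrN opprK mulrA -polyCM mulfV // mul1r //.
rewrite e /inv_series; set y := - _ * 'X.
have -> : 'X * ((x^-1)%:P * (\sum_(l < M) y ^+ l)) * (x%:P * (1 - y)) =
          'X * ((x^-1)%:P * x%:P) * - ((y - 1) * \sum_(l < M) y ^+ l) by ring.
rewrite -subrX1 -polyCM mulVf // /y exprMn_comm; last exact: mulrC.
by rewrite exprS; ring.
Qed.

(** The partial fraction identity
1 / ((s - a)(s - b)) = (1 / (s - a) - 1 / (s - b)) / (a - b), with both sides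
multiplied by X^2. *)
Lemma local_factor_split M x y : exists h,
  (y - x)%:P * (local_factor M x * local_factor M y) =
  'X * (local_factor M x - local_factor M y) + 'X^(M.+1) * h.
Proof.
have [h hx] := local_factorM M x; have [k ky] := local_factorM M y.
exists (local_factor M x * k - local_factor M y * h).
have -> : (y - x)%:P * (local_factor M x * local_factor M y) =
  local_factor M x * (local_factor M y * (y%:P + 'X)) -
  local_factor M y * (local_factor M x * (x%:P + 'X)) by rewrite polyCB; ring.
by rewrite hx ky; ring.
Qed.

Lemma local_factor0 M x : (local_factor M x)`_0 = (x == 0)%:R.
Proof. by rewrite /local_factor; case: eqP => _; rewrite ?coef1 // coefXM. Qed.

(** Induction on the number of factors. When two of the poles differ, the
partial fraction identity removes one of them; when they all coincide, there
is a single pole and the coefficient is read off directly. The right-hand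
side is the residue at infinity, up to sign. *)
Lemma residue_sum M F s : uniq F -> {subset s <= F} -> (0 < size s <= M.+1)%N ->
  \sum_(c <- F) (\prod_(a <- s) local_factor M (c - a))`_(size s).-1 = (size s == 1)%:R.
Proof.
move=> uF; have [k] := ubnP (size s); elim: k s => // k IH s sk sF /andP[].
case: s sk sF => // a [_ sF _ _|b t sk sF _ sM].
  rewrite /= (bigD1_seq a) ?sF ?mem_head //= big_seq1 local_factor0 subrr eqxx.
  rewrite big1 ?addr0 // => c ca; rewrite big_seq1 local_factor0 subr_eq0.
  by rewrite (negPf ca).
have [|] := boolP (all (pred1 a) (b :: t)).
  move=> /allP et; apply: big1 => c _.
  rewrite (eq_big_seq (fun=> local_factor M (c - a))); last first.
    by move=> z; rewrite inE => /orP[/eqP -> //|/et /eqP ->].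
  rewrite big_const_seq count_predT iter_mulr_1 /local_factor.
  case: eqP => _; first by rewrite expr1n coef1.
  by rewrite exprMn coefXnM ltnS leqnn.
rewrite -has_predC => /hasP[x xt /= xa].
have := perm_to_rem xt; set t' := rem x _ => pt.
have st' : size (b :: t) = (size t').+1 by rewrite (perm_size pt).
have eP c : \prod_(a0 <- a :: b :: t) local_factor M (c - a0) =
    local_factor M (c - a) * (local_factor M (c - x) * \prod_(a0 <- t') local_factor M (c - a0)).
  by rewrite big_cons (perm_big _ pt) big_cons.
have sub' : {subset t' <= F}.
  by move=> z zt; apply: sF; rewrite inE (perm_mem pt) inE zt !orbT.
have sz : ((size t').+1 < k)%N by move: sk st' => /=; lia.
have IHa := IH (a :: t') _ _ _; have IHx := IH (x :: t') _ _ _.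
have dax : a - x != 0 by rewrite subr_eq0 eq_sym.
apply: (mulfI dax); rewrite mulr0 mulr_sumr.
rewrite -[RHS](subrr ((size (a :: t') == 1)%:R : R)) -{1}IHa; last 3 first.
- by [].
- by move=> z; rewrite inE => /orP[/eqP ->|/sub' //]; apply: sF; rewrite mem_head.
- by move: sM st' => /=; lia.
have -> : (size (a :: t') == 1)%N = (size (x :: t') == 1)%N by [].
rewrite -IHx; last 3 first.
- by [].
- by move=> z; rewrite inE => /orP[/eqP ->|/sub' //]; apply: sF; rewrite inE xt orbT.
- by move: sM st' => /=; lia.
rewrite -sumrB; apply: eq_bigr => c _.
rewrite eP -coefCM.
have [h hh] := local_factor_split M (c - a) (c - x).
have -> : a - x = c - x - (c - a) by ring.
rewrite !mulrA -(mulrA _ (local_factor _ _) (local_factor _ _)) hh mulrDl coefD.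
rewrite -!mulrA coefXM coefXnM /= (_ : size t = size t') /=; last by case: st'.
have -> : ((size t').+1 < M.+1)%N by move: sM st' => /=; lia.
by rewrite addr0 mulrBl coefB !big_cons.
Qed.

(** Families of local expansions, indexed by the base point c, of linear
combinations of products of between e and D simple fractions with poles in F,
all multiplied by X^D. The bound e records the order of vanishing at
infinity. *)
Inductive fraction (M : nat) F (e D : nat) : (R -> {poly R}) -> Prop :=
| fraction_mono s : {subset s <= F} -> (e <= size s <= D)%N ->
    fraction M F e D (fun c => 'X^(D - size s) * \prod_(a <- s) local_factor M (c - a))
| fraction0 : fraction M F e D (fun=> 0)
| fractionD f g : fraction M F e D f -> fraction M F e D g -> fraction M F e D (fun c => f c + g c)
| fractionZ k f : fraction M F e D f -> fraction M F e D (fun c => k%:P * f c).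

Lemma fraction_ext M F e D f g : fraction M F e D f -> f =1 g -> fraction M F e D g.
Proof. by move=> hf /funext <-. Qed.

Lemma fractionM M F e1 D1 e2 D2 f g : fraction M F e1 D1 f -> fraction M F e2 D2 g ->
  fraction M F (e1 + e2) (D1 + D2) (fun c => f c * g c).
Proof.
move=> hf hg; elim: hf => [s sF hs||f1 f2 _ h1 _ h2|k f1 _ h1].
- elim: hg => [t tF ht||g1 g2 _ h1 _ h2|k g1 _ h1].
  + rewrite (_ : (fun c => _) = fun c => 'X^(D1 + D2 - size (s ++ t)) *
       \prod_(a <- s ++ t) local_factor M (c - a)).
      have stF : {subset s ++ t <= F} by move=> z; rewrite mem_cat => /orP[/sF|/tF].
      by apply: (fraction_mono M stF); rewrite size_cat; lia.
    apply/funext => c; rewrite big_cat size_cat /=.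
    rewrite (_ : (D1 + D2 - (size s + size t) = D1 - size s + (D2 - size t))%N); last lia.
    by rewrite exprD mulrACA.
  + by apply: fraction_ext (fraction0 _ _ _ _) _ => c; rewrite mulr0.
  + by apply: fraction_ext (fractionD h1 h2) _ => c; rewrite mulrDr.
  + by apply: fraction_ext (fractionZ k h1) _ => c; rewrite mulrCA.
- by apply: fraction_ext (fraction0 _ _ _ _) _ => c; rewrite mul0r.
- by apply: fraction_ext (fractionD h1 h2) _ => c; rewrite mulrDl.
- by apply: fraction_ext (fractionZ k h1) _ => c; rewrite mulrA.
Qed.

Lemma fraction_residue M F D f : uniq F -> (D <= M.+1)%N -> fraction M F 2 D f ->
  \sum_(c <- F) (f c)`_D.-1 = 0.
Proof.
move=> uF DM; elim=> [s sF /andP[s2 sD]||f1 f2 _ h1 _ h2|k f1 _ h1].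
- transitivity ((size s == 1)%:R : R); last by case: (size s) s2 => [|[|]].
  rewrite -(@residue_sum M F s) //; last by lia.
  apply: eq_bigr => c _; rewrite coefXnM ifN; last by lia.
  by congr (_`_ _); lia.
- by rewrite big1 // => c _; rewrite coef0.
- by under eq_bigr do rewrite coefD; rewrite big_split /= h1 h2 addr0.
- by under eq_bigr do rewrite coefCM; rewrite -mulr_sumr h1 mulr0.
Qed.

Lemma fraction_factor M F e p a : a \in F -> (e <= p)%N ->
  fraction M F e p (fun c => local_factor M (c - a) ^+ p).
Proof.
move=> aF ep; have := @fraction_mono M F e p (nseq p a); rewrite size_nseq leqnn ep.
rewrite (_ : (fun c => _) = fun c => local_factor M (c - a) ^+ p).
  by apply => // z; rewrite mem_nseq => /andP[_ /eqP ->].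
apply/funext => c; rewrite subnn expr0 mul1r big_nseq.
by elim: (p) => //= n ->; rewrite exprS.
Qed.

Lemma fraction_monomial M F D k : fraction M F 0 D (fun=> k%:P * 'X^D).
Proof.
apply: fractionZ; have := @fraction_mono M F 0 D [::].
by rewrite subn0 (_ : (fun c => _) = fun=> 'X^D);
  [apply|apply/funext => c; rewrite big_nil mulr1].
Qed.

Lemma fraction_sum M F e D I (r : seq I) (f : I -> R -> {poly R}) :
  (forall i, fraction M F e D (f i)) -> fraction M F e D (fun c => \sum_(i <- r) f i c).
Proof.
move=> h; elim: r => [|i r IH].
  by rewrite (_ : (fun c => _) = fun=> 0); [exact: fraction0|apply/funext => c; rewrite big_nil].
rewrite (_ : (fun c => _) = fun c => f i c + \sum_(j <- r) f j c); first exact: fractionD.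
by apply/funext => c; rewrite big_cons.
Qed.

Lemma fraction_prod M F I (r : seq I) (d : I -> nat) (f : I -> R -> {poly R}) :
  (forall i, fraction M F 0 (d i) (f i)) ->
  fraction M F 0 (\sum_(i <- r) d i) (fun c => \prod_(i <- r) f i c).
Proof.
move=> h; elim: r => [|i r IH].
  rewrite big_nil (_ : (fun c => _) = fun=> 1%:P * 'X^0); first exact: fraction_monomial.
  by apply/funext => c; rewrite big_nil mulr1.
rewrite big_cons (_ : (fun c => _) = fun c => f i c * \prod_(j <- r) f j c).
  exact: (fractionM (e1 := 0) (e2 := 0)).
by apply/funext => c; rewrite big_cons.
Qed.

(** Substituting x X for X in 1 / (x + X): up to a factor independent of x, the
coefficients are powers of 1 / x. *)
Lemma inv_series_scale M x p l :
  (inv_series M x ^+ p)`_l = (inv_series M 1 ^+ p)`_l * x ^- (p + l).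
Proof.
have e : inv_series M x = (x^-1)%:P * (inv_series M 1 \Po ((x^-1)%:P * 'X)).
  rewrite /inv_series invr1 mul1r rmorph_sum /=; congr (_ * _); apply: eq_bigr => i _.
  by rewrite rmorphXn rmorphM rmorphN /= comp_polyC comp_polyX mulN1r mulNr.
rewrite e exprMn -rmorphXn -rmorphXn /= coefCM mulrC -exprVn.
rewrite (exprD _ p) [RHS]mulrCA [LHS]mulrC; congr (_ * _).
move: (inv_series M 1 ^+ p) => P.
rewrite comp_polyE coef_sum.
under eq_bigr do rewrite coefZ exprMn -rmorphXn /= coefCM coefXn.
have [lP|Pl] := ltnP l (size P).
  rewrite (bigD1 (Ordinal lP)) //= eqxx mulr1 big1 ?addr0 // => i il.
  by rewrite (_ : l == i = false) ?mulr0 //; apply: contra_neqF il => /eqP h; apply/val_inj.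
rewrite nth_default // mul0r big1 // => i _.
by rewrite (_ : l == i = false) ?mulr0 //; apply/eqP => h; have := ltn_ord i; rewrite -h ltnNge Pl.
Qed.

Lemma inv_series0 M p : (0 < M)%N -> (inv_series M 1 ^+ p)`_0 = 1.
Proof.
case: M => // M _; rewrite -horner_coef0 horner_exp.
rewrite /inv_series hornerM hornerC invr1 mul1r horner_sum big_ord_recl expr0 hornerC.
rewrite big1 ?addr0 ?expr1n // => i _.
by rewrite horner_exp hornerM hornerX mulr0 expr0n.
Qed.

Lemma local_factorX M x p : x != 0 ->
  local_factor M x ^+ p = 'X^p * inv_series M x ^+ p.
Proof. by rewrite /local_factor => /negPf ->; rewrite exprMn. Qed.
Lemma local_factor_eq0 M : local_factor M 0 = 1.
Proof. by rewrite /local_factor eqxx. Qed.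
End Residues.

(** * Polynomials in harmonic sums *)

Section HarmonicPolynomials.
Variables (R : realType) (r : nat).
Local Notation red := (@reduces_to_lower_orders R r).
Local Notation T := (@signed_sum R).

Lemma harmonic_sumE e n : harmonic_sum R e n =
  sgn R (if e is Bar _ then true else false) *
  T (if e is Bar _ then true else false) (index_val e) n.
Proof.
case: e => p; rewrite /signed_sum mulr_sumr; apply: eq_big_nat => k /andP[k0 _] /=.
  by rewrite /sgn expr0 expr1n !mul1r.
by case: k k0 => // k _; rewrite /sgn expr1 exprS -mulrA !mulN1r opprK.
Qed.

Definition bar_index (b : bool) P := if b then Bar P else Plain P.

(** The sign (-1)^(k-1) of barred harmonic sums is - (-1)^k. *)
Lemma signed_sumE b P n : T b P n = sgn R b * harmonic_sum R (bar_index b P) n.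
Proof.
rewrite harmonic_sumE mulrA; case: b => /=; rewrite -expr2 /sgn sqrr_sign mul1r //.
Qed.

Lemma norm_signed_sum b P n : (0 < P)%N -> `|T b P n| <= harm R n.
Proof.
by move=> P0; have := signed_sum_diff_harm R b 0 n P0; rewrite add0n signed_sum0 subr0.
Qed.

(** Polynomials of degree at most d in the harmonic sums at n, with reducible
coefficients, as functions of n. *)
Inductive hpoly (d : nat) : (nat -> R) -> Prop :=
| hpoly_mono c (es : seq eindex) : red c -> (size es <= d)%N ->
    all (fun e => 0 < index_val e)%N es ->
    hpoly d (fun n => c * \prod_(e <- es) harmonic_sum R e n)
| hpolyD f g : hpoly d f -> hpoly d g -> hpoly d (fun n => f n + g n).

Lemma hpoly_ext d f g : hpoly d f -> f =1 g -> hpoly d g.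
Proof. by move=> hf /funext <-. Qed.

Lemma hpolyW d d' f : (d <= d')%N -> hpoly d f -> hpoly d' f.
Proof.
move=> dd'; elim=> [c es hc hs he|f1 f2 _ h1 _ h2]; last exact: hpolyD.
by apply: hpoly_mono => //; exact: leq_trans dd'.
Qed.

Lemma hpoly_cst d c : red c -> hpoly d (fun=> c).
Proof.
move=> hc; apply: (hpoly_ext (@hpoly_mono d c [::] hc isT isT)) => n.
by rewrite big_nil mulr1.
Qed.

Lemma hpolyM d1 d2 f g : hpoly d1 f -> hpoly d2 g -> hpoly (d1 + d2) (fun n => f n * g n).
Proof.
move=> hf hg; elim: hf => [c es hc hs he|f1 f2 _ h1 _ h2]; last first.
  by apply: hpoly_ext (hpolyD h1 h2) _ => n; rewrite mulrDl.
elim: hg => [c' es' hc' hs' he'|f1 f2 _ h1 _ h2]; last first.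
  by apply: hpoly_ext (hpolyD h1 h2) _ => n; rewrite mulrDr.
apply: hpoly_ext (@hpoly_mono _ (c * c') (es ++ es') (redM hc hc') _ _) _.
- by rewrite size_cat leq_add.
- by rewrite all_cat he he'.
- by move=> n; rewrite big_cat mulrACA.
Qed.

Lemma hpoly_signed_sum b P : (0 < P)%N -> hpoly 1 (T b P).
Proof.
move=> P0; apply: hpoly_ext (@hpoly_mono 1 (sgn R b) [:: bar_index b P] _ _ _) _ => //.
- by have := red_sign R r b 1; rewrite expr1.
- by case: b; rewrite /= P0.
- by move=> n; rewrite big_seq1 signed_sumE.
Qed.

(** Growth at most that of a power of log n. *)
Definition log_bounded (f : nat -> R) :=
  exists C m, 0 <= C /\ forall n, `|f n| <= C * (1 + harm R n) ^+ m.

Lemma log_boundedM f g : log_bounded f -> log_bounded g -> log_bounded (fun n => f n * g n).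
Proof.
move=> [C [m [C0 hf]]] [D [k [D0 hg]]]; exists (C * D), (m + k)%N; split; first exact: mulr_ge0.
by move=> n; rewrite normrM exprD mulrACA ler_pM.
Qed.

Lemma harm_exp_le m k n : (1 + harm R n) ^+ m <= (1 + harm R n) ^+ maxn m k.
Proof. by rewrite ler_weXn2l ?leq_maxl // lerDl harm_ge0. Qed.

Lemma log_boundedD f g : log_bounded f -> log_bounded g -> log_bounded (fun n => f n + g n).
Proof.
move=> [C [m [C0 hf]]] [D [k [D0 hg]]]; exists (C + D), (maxn m k); split; first exact: addr_ge0.
move=> n; apply: le_trans (ler_normD _ _) _; rewrite mulrDl lerD //.
  by apply: le_trans (hf n) _; rewrite ler_wpM2l // harm_exp_le.
by apply: le_trans (hg n) _; rewrite ler_wpM2l // maxnC harm_exp_le.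
Qed.

Lemma log_bounded_cst c : log_bounded (fun=> c).
Proof. by exists `|c|, 0%N; split=> // n; rewrite expr0 mulr1. Qed.

Lemma log_bounded_signed_sum b P : (0 < P)%N -> log_bounded (T b P).
Proof.
move=> P0; exists 1, 1%N; split=> // n; rewrite mul1r expr1.
by apply: le_trans (norm_signed_sum b n P0) _; rewrite lerDr.
Qed.

Lemma hpoly_log_bounded d f : hpoly d f -> log_bounded f.
Proof.
elim=> [c es _ _|f1 f2 _ h1 _ h2]; last exact: log_boundedD.
elim: es c => [|e es IH] c.
  move=> _; rewrite (_ : (fun n => _) = fun=> c); first exact: log_bounded_cst.
  by apply/funext => n; rewrite big_nil mulr1.
move=> /= /andP[e0 /IH h].
rewrite (_ : (fun n => _) = fun n => (sgn R (if e is Bar _ then true else false) *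
    T (if e is Bar _ then true else false) (index_val e) n) *
    (c * \prod_(e <- es) harmonic_sum R e n)); last first.
  by apply/funext => n; rewrite big_cons harmonic_sumE mulrCA.
apply: log_boundedM (h c); apply: log_boundedM; first exact: log_bounded_cst.
exact: log_bounded_signed_sum.
Qed.

(** The general term of R-sums and of the sums of residues. *)
Definition weighted b q (f : nat -> R) n := sgn R b ^+ n * f n * (n%:R + 2^-1) ^- q.

Lemma weighted_le b q f C m n : (1 < q)%N -> 0 <= C ->
  `|f n| <= C * (1 + harm R n) ^+ m ->
  `|weighted b q f n| <= C * (2 ^+ q * 2) * logw R m n.
Proof.
move=> q1 C0 hf; rewrite /weighted !normrM norm_sgn mul1r.
have x0 : 0 < n%:R + 2^-1 :> R by rewrite ltr_wpDl.
rewrite [X in _ * X]gtr0_norm ?invr_gt0 ?exprn_gt0 //.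
apply: (@le_trans _ _ (C * (1 + harm R n) ^+ m * (n%:R + 2^-1) ^- q)).
  by rewrite ler_wpM2r // invr_ge0 exprn_ge0 // ltW.
rewrite -!(mulrA C) ler_wpM2l // inv_pow_le //.
rewrite -natr1; have : 0 <= n%:R :> R by []. lra.
Qed.

Lemma weighted_tends b q f : (1 < q)%N -> log_bounded f ->
  exists l, tends (psum (weighted b q f)) l.
Proof.
move=> q1 [C [m [C0 hf]]].
apply: (psum_dominated (b := fun n => C * (2 ^+ q * 2) * logw R m n)).
  by move=> n; exact: weighted_le.
exact: tends_scaled_logw.
Qed.

Lemma lim_sum0 (F : nat -> R) l :
  tends (psum F) l -> \big[+%R/0]_(0 <= k <oo) F k = l.
Proof. by move=> /psum_series h; exact: tends_lim. Qed.

Lemma Rsum_weighted b q s (e : 'I_s -> eindex) l :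
  tends (psum (weighted b q (fun n => \prod_(j < s) harmonic_sum R (e j) n))) l ->
  Rsum R e (bar_index b q) = l.
Proof.
move=> h; case: b h => h; apply: lim_sum0; congr (tends (psum _) _): h;
  apply/funext => n; rewrite /weighted /sgn.
  by rewrite expr1 -mulrA mulrC.
by rewrite expr0 expr1n mul1r.
Qed.

(** For d < r the terms of the expansion are, up to reducible factors, sums of
order less than r. *)
Lemma hpoly_series b q d g : (1 < q)%N -> (d < r)%N -> hpoly d g ->
  exists l, red l /\ tends (psum (weighted b q g)) l.
Proof.
move=> q1 dr hf; have := hpoly_log_bounded hf; elim: hf => [c es hc hs he _|f1 f2 h1 IH1 h2 IH2 _].
  pose f n := \prod_(j < size es) harmonic_sum R (tnth (in_tuple es) j) n.
  have hf : hpoly d f.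
    apply: hpoly_ext (@hpoly_mono d 1 es (red1 R r) hs he) _ => n.
    by rewrite mul1r big_tnth.
  have [l hl] := @weighted_tends b q f q1 (hpoly_log_bounded hf).
  exists (c * l); split.
    apply: redM hc _; rewrite -(Rsum_weighted hl); apply: red_value; apply: LowerRsum.
    - exact: leq_ltn_trans dr.
    - exact: (elimT (@all_tnthP _ _ (fun e => 0 < index_val e)%N (in_tuple es)) he).
    - by case: b {hl}.
  rewrite (_ : psum _ = fun n => c * psum (weighted b q f) n).
    by apply: tendsM => //; exact: tends_cst.
  apply/funext => n; rewrite /psum mulr_sumr; apply: eq_bigr => k _.
  by rewrite /weighted /f big_tnth; ring.
have [l1 [r1 t1]] := IH1 (hpoly_log_bounded h1).
have [l2 [r2 t2]] := IH2 (hpoly_log_bounded h2).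
exists (l1 + l2); split; first exact: redD.
rewrite (_ : psum _ = fun n => psum (weighted b q f1) n + psum (weighted b q f2) n).
  exact: tendsD.
apply/funext => n; rewrite /psum -big_split; apply: eq_bigr => k _.
by rewrite /weighted /=; ring.
Qed.

(** Only n <= N is constrained: the residue at n is considered for the partial
sums of length N, with poles at distance at most N. *)
Definition array_bounded (a : nat -> nat -> R) :=
  exists C m, 0 <= C /\ forall N n, (n <= N)%N -> `|a N n| <= C * (1 + harm R n) ^+ m.

(** Arrays a N n to which Tannery's theorem applies, and whose limit for large
N is a polynomial of degree at most d in the harmonic sums at n. *)
Definition hpoly_array d (a : nat -> nat -> R) :=
  (exists f, hpoly d f /\ forall n, tends (a^~ n) (f n)) /\ array_bounded a.

Lemma weighted_tannery b q a f : (1 < q)%N -> array_bounded a ->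
  (forall n, tends (a^~ n) (f n)) ->
  exists l, tends (psum (weighted b q f)) l /\
            tends (fun N => psum (weighted b q (a N)) N) l.
Proof.
move=> q1 [C [m [C0 ha]]] hf.
apply: (tannery (a := fun N => weighted b q (a N)) (b := fun n => C * (2 ^+ q * 2) * logw R m n)).
- by move=> N n nN; apply: weighted_le => //; exact: ha.
- exact: tends_scaled_logw.
- move=> n; apply: (tendsM (u := fun N => sgn R b ^+ n * a N n)); last exact: tends_cst.
  by apply: tendsM => //; exact: tends_cst.
Qed.

Lemma hpoly_array_tannery b q d a : (1 < q)%N -> (d < r)%N -> hpoly_array d a ->
  exists l, red l /\ tends (fun N => psum (weighted b q (a N)) N) l.
Proof.
move=> q1 dr [[f [hf taf]] ba].
have [l [hl tl]] := weighted_tannery b q1 ba taf.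
have [l' [hl' tl']] := hpoly_series b q1 dr hf.
by exists l; split=> //; rewrite (tends_uniq hl tl').
Qed.

Lemma array_boundedM a b : array_bounded a -> array_bounded b -> array_bounded (fun N n => a N n * b N n).
Proof.
move=> [C [m [C0 hf]]] [D [k [D0 hg]]]; exists (C * D), (m + k)%N; split; first exact: mulr_ge0.
by move=> N n nN; rewrite normrM exprD mulrACA ler_pM // ?hf ?hg.
Qed.
Lemma array_boundedD a b : array_bounded a -> array_bounded b -> array_bounded (fun N n => a N n + b N n).
Proof.
move=> [C [m [C0 hf]]] [D [k [D0 hg]]]; exists (C + D), (maxn m k); split; first exact: addr_ge0.
move=> N n nN; apply: le_trans (ler_normD _ _) _; rewrite mulrDl lerD //.
  by apply: le_trans (hf N n nN) _; rewrite ler_wpM2l // harm_exp_le.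
by apply: le_trans (hg N n nN) _; rewrite ler_wpM2l // maxnC harm_exp_le.
Qed.

Lemma hpoly_array_ext d a b : hpoly_array d a -> (forall N n, a N n = b N n) -> hpoly_array d b.
Proof. by move=> ha e; rewrite (_ : b = a) //; apply/funext => N; apply/funext => n. Qed.
Lemma hpoly_arrayW d d' a : (d <= d')%N -> hpoly_array d a -> hpoly_array d' a.
Proof.
by move=> dd [[f [hf tf]] ba]; split => //; exists f; split=> //; exact: hpolyW hf.
Qed.
Lemma hpoly_arrayD d a b : hpoly_array d a -> hpoly_array d b -> hpoly_array d (fun N n => a N n + b N n).
Proof.
move=> [[f [hf tf]] ba] [[g [hg tg]] bb]; split; last exact: array_boundedD.
by exists (fun n => f n + g n); split; [exact: hpolyD|move=> n; exact: tendsD].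
Qed.
Lemma hpoly_arrayM d1 d2 a b : hpoly_array d1 a -> hpoly_array d2 b -> hpoly_array (d1 + d2) (fun N n => a N n * b N n).
Proof.
move=> [[f [hf tf]] ba] [[g [hg tg]] bb]; split; last exact: array_boundedM.
by exists (fun n => f n * g n); split; [exact: hpolyM|move=> n; exact: tendsM].
Qed.
Lemma hpoly_array_seq d u l : red l -> tends u l -> hpoly_array d (fun N n => u N).
Proof.
move=> hl hu; split; first by exists (fun=> l); split; [exact: hpoly_cst|].
have [B [B0 hB]] := tends_bounded hu.
by exists B, 0%N; split=> // N n _; rewrite expr0 mulr1.
Qed.
Lemma hpoly_array_cst d c : red c -> hpoly_array d (fun N n => c).
Proof. by move=> hc; apply: (@hpoly_array_seq d (fun=> c) c) => //; exact: tends_cst. Qed.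
Lemma hpoly_arrayZ d c a : red c -> hpoly_array d a -> hpoly_array d (fun N n => c * a N n).
Proof. by move=> hc ha; exact: (hpoly_arrayM (@hpoly_array_cst 0 c hc) ha). Qed.
Lemma hpoly_array_signed_sum b P : (0 < P)%N -> hpoly_array 1 (fun N n => T b P n).
Proof.
move=> P0; split; first by exists (T b P); split; [exact: hpoly_signed_sum|move=> n; exact: tends_cst].
by have [C [m [C0 h]]] := log_bounded_signed_sum b P0; exists C, m; split.
Qed.
Lemma hpoly_array_backshift d b P : (0 < P)%N -> hpoly_array d (fun N n => T b P (N - n) - T b P N).
Proof.
move=> P0; split.
  exists (fun=> 0); split; first exact: hpoly_cst (red0 R r).
  by move=> n; exact: signed_sum_backshift.
exists 1, 1%N; split=> // N n nN; rewrite mul1r expr1 distrC -{1}(subnK nN).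
by apply: le_trans (signed_sum_diff_harm _ _ _ _ P0) _; rewrite lerDr.
Qed.
Lemma hpoly_array_foreshift d b P : (0 < P)%N -> hpoly_array d (fun N n => T b P (N + n.+1) - T b P N).
Proof.
move=> P0; split.
  exists (fun=> 0); split; first exact: hpoly_cst (red0 R r).
  by move=> n; exact: signed_sum_foreshift.
exists 1, 1%N; split=> // N n nN; rewrite mul1r expr1.
apply: le_trans (signed_sum_diff_harm _ _ _ _ P0) _; rewrite harmS addrC lerD2r.
by rewrite invf_le1 // ler1n.
Qed.

Lemma hpoly_array_sum d I (s : seq I) (F : I -> nat -> nat -> R) :
  (forall i, hpoly_array d (F i)) -> hpoly_array d (fun N n => \sum_(i <- s) F i N n).
Proof.
move=> h; elim: s => [|i s IH].
  by apply: hpoly_array_ext (hpoly_array_cst d (red0 R r)) _ => N n; rewrite big_nil.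
by apply: hpoly_array_ext (hpoly_arrayD (h i) IH) _ => N n; rewrite big_cons.
Qed.

(** The version of [hpoly_array] for local expansions, coefficientwise. *)
Definition hpoly_coefs d (P : nat -> nat -> {poly R}) := forall i, hpoly_array d (fun N n => (P N n)`_i).

Lemma hpoly_coefsW d d' P : (d <= d')%N -> hpoly_coefs d P -> hpoly_coefs d' P.
Proof. by move=> dd h i; exact: hpoly_arrayW dd (h i). Qed.
Lemma hpoly_coefsD d P Q : hpoly_coefs d P -> hpoly_coefs d Q -> hpoly_coefs d (fun N n => P N n + Q N n).
Proof. by move=> hP hQ i; apply: hpoly_array_ext (hpoly_arrayD (hP i) (hQ i)) _ => N n; rewrite coefD. Qed.
Lemma hpoly_coefsM d1 d2 P Q : hpoly_coefs d1 P -> hpoly_coefs d2 Q -> hpoly_coefs (d1 + d2) (fun N n => P N n * Q N n).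
Proof.
move=> hP hQ i.
have := @hpoly_array_sum (d1 + d2) _ (index_enum 'I_i.+1) _ (fun j : 'I_i.+1 => hpoly_arrayM (hP j) (hQ (i - j)%N)).
by move/hpoly_array_ext; apply => N n; rewrite coefM.
Qed.
Lemma hpoly_coefsXn d k P : hpoly_coefs d P -> hpoly_coefs d (fun N n => 'X^k * P N n).
Proof.
move=> hP i; have [ik|ki] := ltnP i k.
  by apply: hpoly_array_ext (hpoly_array_cst d (red0 R r)) _ => N n; rewrite coefXnM ik.
by apply: hpoly_array_ext (hP (i - k)%N) _ => N n; rewrite coefXnM ltnNge ki.
Qed.
Lemma hpoly_coefs_cst d c : red c -> hpoly_coefs d (fun N n => c%:P).
Proof.
move=> hc [|i].
  by apply: hpoly_array_ext (hpoly_array_cst d hc) _ => N n; rewrite coefC.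
by apply: hpoly_array_ext (hpoly_array_cst d (red0 R r)) _ => N n; rewrite coefC.
Qed.
Lemma hpoly_coefs_prod I (s : seq I) (P : I -> nat -> nat -> {poly R}) :
  (forall i, hpoly_coefs 1 (P i)) -> hpoly_coefs (size s) (fun N n => \prod_(i <- s) P i N n).
Proof.
move=> h; elim: s => [|i s IH] k.
  by apply: hpoly_array_ext (hpoly_coefs_cst 0 (red1 R r) k) _ => N n; rewrite big_nil.
by apply: hpoly_array_ext (hpoly_coefsM (h i) IH k) _ => N n; rewrite big_cons.
Qed.

(** Each factor is a multiple of a harmonic sum up to a constant; replacing any
of the sums with its constant lowers the degree. *)
Lemma hpoly_prod_shift I (j : I) (s : seq I) (c al : I -> R) (b : I -> bool) (p : I -> nat) :
  (forall i, 0 < p i)%N -> (forall i, red (c i)) -> (forall i, red (al i)) ->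
  exists h, hpoly (size s) h /\ forall n,
    \prod_(i <- j :: s) (c i * T (b i) (p i) n + al i) =
    (\prod_(i <- j :: s) c i) * (\prod_(i <- j :: s) T (b i) (p i) n) + h n.
Proof.
move=> p0 hc hal; elim: s j => [|k s IH] j.
  by exists (fun=> al j); split; [exact: hpoly_cst|move=> n; rewrite !big_seq1].
have [h [hh eh]] := IH k.
have hT i : hpoly 1 (fun n => c i * T (b i) (p i) n).
  exact: (hpolyM (hpoly_cst 0 (hc i)) (hpoly_signed_sum (b i) (p0 i))).
have hprod t : hpoly (size t) (fun n => (\prod_(i <- t) (c i * T (b i) (p i) n))).
  elim: t => [|i t IHt].
    by apply: hpoly_ext (hpoly_cst 0 (red1 R r)) _ => n; rewrite big_nil.
  by apply: hpoly_ext (hpolyM (hT i) IHt) _ => n; rewrite big_cons.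
exists (fun n => c j * T (b j) (p j) n * h n +
   (al j * \prod_(i <- k :: s) (c i * T (b i) (p i) n) + al j * h n)); split.
  apply: hpolyD; first exact: (hpolyM (hT j) hh).
  apply: hpolyD; first exact: (hpolyM (hpoly_cst 0 (hal j)) (hprod (k :: s))).
  apply: hpolyW (leqnSn _) _; exact: (hpolyM (hpoly_cst 0 (hal j)) hh).
move=> n; rewrite big_split /= big_cons eh.
rewrite [X in X * _ + (_ + _)]big_cons [X in _ * X + (_ + _)]big_cons.
set A := \prod_(_ <- _) _; set B := \prod_(_ <- _) _; ring.
Qed.

(** In a product of local expansions with polar part 1, choosing this polar
part in at least one of the factors leaves a product of fewer harmonic sums.
The error term E gathers all these choices. *)
Lemma hpoly_coefs_prod_poles I (j : I) (s : seq I) (W : I -> nat -> nat -> {poly R}) (p : I -> nat) :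
  (forall i, hpoly_coefs 1 (W i)) ->
  exists E, hpoly_coefs (size s) E /\ forall N n,
    \prod_(i <- j :: s) (1 + 'X^(p i) * W i N n) =
    'X^(\sum_(i <- j :: s) p i) * (\prod_(i <- j :: s) W i N n) + E N n.
Proof.
move=> hW; elim: s j => [|k s IH] j.
  exists (fun _ _ => 1%:P); split; first exact: hpoly_coefs_cst (red1 R r).
  by move=> N n; rewrite !big_seq1 addrC.
have [E [hE eE]] := IH k.
exists (fun N n => 'X^(p j) * (W j N n * E N n) +
   ('X^(\sum_(i <- k :: s) p i) * (\prod_(i <- k :: s) W i N n) + E N n)); split.
  apply: hpoly_coefsD; first by apply: hpoly_coefsXn; exact: hpoly_coefsM (hW j) hE.
  apply: hpoly_coefsD; first by apply: hpoly_coefsXn; exact: (@hpoly_coefs_prod _ (k :: s)).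
  exact: hpoly_coefsW (leqnSn _) hE.
move=> N n; rewrite big_cons eE 2!(big_cons _ _ j) exprD; ring.
Qed.
End HarmonicPolynomials.

(** * Local expansions at the poles *)

Section LocalExpansions.
Variables (R : realType) (r M : nat).
Hypothesis M0 : (0 < M)%N.
Local Notation red := (@reduces_to_lower_orders R r).
Local Notation T := (@signed_sum R).
Local Notation sgn := (@sgn R).
Local Notation lf := (@local_factor R M).
Local Notation inv := (@inv_series R M).

(** The coefficients of the p-th power of the truncated expansion of
1 / (1 + X). They are integers, hence reducible. *)
Definition inv_coef p l : R := (inv 1 ^+ p)`_l.

Lemma red_inv_coef p l : red (inv_coef p l).
Proof.
apply: red_coefX => i; apply: red_coefM => k.
  by rewrite invr1 coefC; case: eqP => _; [exact: red1|exact: red0].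
rewrite coef_sum; apply: red_sum => m _; apply: red_coefX => t.
rewrite invr1 mulN1r coefN coefX; apply: redN.
by case: eqP => _; [exact: red1|exact: red0].
Qed.

Lemma inv_coef0 p : inv_coef p 0 = 1. Proof. exact: inv_series0. Qed.

Lemma coef_inv_natr b p l m n :
  (\sum_(m <= k < n) (sgn b ^+ k)%:P * inv k%:R ^+ p)`_l =
  inv_coef p l * \sum_(m <= k < n) sgn b ^+ k * k%:R ^- (p + l).
Proof.
rewrite coef_sum mulr_sumr; apply: eq_bigr => k _.
by rewrite coefCM inv_series_scale mulrCA.
Qed.

Lemma invrXN (x : R) n : (- x) ^- n = (-1) ^+ n * x ^- n.
Proof. by rewrite [(- x) ^+ n]exprNn invfM -[in LHS]exprVn invrN1. Qed.

Lemma coef_inv_oppr b p l m n :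
  (\sum_(m <= k < n) (sgn b ^+ k)%:P * inv (- k%:R) ^+ p)`_l =
  inv_coef p l * ((-1) ^+ (p + l) * \sum_(m <= k < n) sgn b ^+ k * k%:R ^- (p + l)).
Proof.
rewrite coef_sum !mulr_sumr; apply: eq_bigr => k _.
by rewrite coefCM inv_series_scale invrXN; rewrite /inv_coef; ring.
Qed.

Definition right_poles b p N (c : R) : {poly R} :=
  \sum_(0 <= k < N.+1) (sgn b ^+ k)%:P * lf (c - k%:R) ^+ p.
Definition left_poles b p N (c : R) : {poly R} :=
  \sum_(0 <= k < N.+1) (sgn b ^+ k.+1)%:P * lf (c + k.+1%:R) ^+ p.

(** Recentering at n: the character factors as eps^n eps^m, with m = n - k, so
that the range 0..N becomes a range around 0 of radii n and N - n. *)
Lemma sum_around b N n (h : R -> {poly R}) : (n <= N)%N ->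
  \sum_(0 <= k < N.+1) (sgn b ^+ k)%:P * h (n%:R - k%:R) =
  (sgn b ^+ n)%:P * (h 0 + (\sum_(1 <= m < n.+1) (sgn b ^+ m)%:P * h m%:R
                        + \sum_(1 <= m < (N - n).+1) (sgn b ^+ m)%:P * h (- m%:R))).
Proof.
move=> nN; rewrite (big_cat_nat _ (n := n.+1)) //= addrA mulrDr; congr (_ + _).
  rewrite big_nat_rev /= add0n mulrDr mulr_sumr [LHS]big_ltn // subSS subn0 subrr.
  congr (_ + _); apply: eq_big_nat => m /andP[m1 mn].
  rewrite subSS natrB ?subKr; last by [].
  by rewrite mulrA -rmorphM -{2}(subnK (n := n) (m := m)) // exprD -mulrA sgn_mul mulr1.
rewrite -[X in \sum_(X <= _ < _) _]add1n big_addn -subSn // mulr_sumr.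
apply: eq_bigr => m _; rewrite mulrA -rmorphM /= -exprD addnC natrD.
by congr (_ * h _); ring.
Qed.

(** Recentering a range that does not contain the base point. *)
Lemma sum_beyond b N n (h : R -> {poly R}) :
  \sum_(0 <= k < N.+1) (sgn b ^+ k.+1)%:P * h (n + k.+1)%:R =
  (sgn b ^+ n)%:P * \sum_(n.+1 <= m < (N + n.+1).+1) (sgn b ^+ m)%:P * h m%:R.
Proof.
have := big_addn 0 (N + n.+1).+1 n.+1 xpredT (fun m => (sgn b ^+ m)%:P * h m%:R).
rewrite add0n -addSn addnK => /= ->; rewrite mulr_sumr.
apply: eq_bigr => k _; rewrite (_ : k + n.+1 = n + k.+1)%N; last lia.
by rewrite mulrA -rmorphM /= exprD mulrA sgn_mul mul1r.
Qed.

Lemma signed_sum_tail b P N n :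
  \sum_(n.+1 <= m < (N + n.+1).+1) sgn b ^+ m * m%:R ^- P = T b P (N + n.+1) - T b P n.
Proof.
apply/eqP; rewrite eq_sym subr_eq addrC /signed_sum -big_cat_nat //.
by rewrite ltnS; lia.
Qed.

(** The regular parts, divided by the p-th power of the local parameter, of the
expansions of [right_poles] and [left_poles] at an integer n or -n-1,
according to the position of the poles: on both sides, or on one side only. *)
Definition W_around b p N n := \sum_(1 <= m < n.+1) (sgn b ^+ m)%:P * inv m%:R ^+ p
   + \sum_(1 <= m < (N - n).+1) (sgn b ^+ m)%:P * inv (- m%:R) ^+ p.
Definition W_beyond b p N n :=
  \sum_(n.+1 <= m < (N + n.+1).+1) (sgn b ^+ m)%:P * inv m%:R ^+ p.
Definition W_before b p N n :=
  \sum_(n.+1 <= m < (N + n.+1).+1) (sgn b ^+ m)%:P * inv (- m%:R) ^+ p.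

Lemma coef_W_around b p N n l : (W_around b p N n)`_l =
  inv_coef p l * (T b (p + l) n + (-1) ^+ (p + l) * T b (p + l) (N - n)).
Proof. by rewrite coefD coef_inv_natr coef_inv_oppr -mulrDr. Qed.
Lemma coef_W_beyond b p N n l : (W_beyond b p N n)`_l =
  inv_coef p l * (T b (p + l) (N + n.+1) - T b (p + l) n).
Proof. by rewrite coef_inv_natr signed_sum_tail. Qed.
Lemma coef_W_before b p N n l : (W_before b p N n)`_l =
  inv_coef p l * ((-1) ^+ (p + l) * (T b (p + l) (N + n.+1) - T b (p + l) n)).
Proof. by rewrite coef_inv_oppr signed_sum_tail. Qed.

Lemma local_factor_sumX b p m n (g : nat -> R) : (forall k, (m <= k)%N -> g k != 0) ->
  \sum_(m <= k < n) (sgn b ^+ k)%:P * lf (g k) ^+ p =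
  'X^p * \sum_(m <= k < n) (sgn b ^+ k)%:P * inv (g k) ^+ p.
Proof.
move=> hg; rewrite mulr_sumr; apply: eq_big_nat => k /andP[mk _].
by rewrite local_factorX ?hg // mulrCA.
Qed.

Lemma natS_neq0 m k : (m < k)%N -> k%:R != 0 :> R.
Proof. by case: k => // k _; rewrite pnatr_eq0. Qed.
Lemma oppnatS_neq0 m k : (m < k)%N -> - k%:R != 0 :> R.
Proof. by move=> /natS_neq0; rewrite oppr_eq0. Qed.

Lemma right_poles_nat b p N n : (n <= N)%N ->
  right_poles b p N n%:R = (sgn b ^+ n)%:P * (1 + 'X^p * W_around b p N n).
Proof.
move=> nN; rewrite /right_poles (sum_around b (fun x => lf x ^+ p) nN).
rewrite local_factor_eq0 expr1n (local_factor_sumX b p _ (g := fun k => k%:R) (m := 1)); last exact: natS_neq0.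
rewrite (local_factor_sumX b p _ (g := fun k => - k%:R) (m := 1)); last exact: oppnatS_neq0.
by rewrite -mulrDr.
Qed.

Lemma left_poles_nat b p N n :
  left_poles b p N n%:R = (sgn b ^+ n)%:P * ('X^p * W_beyond b p N n).
Proof.
rewrite -(local_factor_sumX b p _ (g := fun k => k%:R) (m := n.+1)); last exact: natS_neq0.
rewrite -(sum_beyond b N n (fun x => lf x ^+ p)); apply: eq_bigr => k _.
by rewrite natrD.
Qed.

Lemma right_poles_neg b p N n :
  right_poles b p N (- n.+1%:R) = (sgn b ^+ n.+1)%:P * ('X^p * W_before b p N n).
Proof.
rewrite -(local_factor_sumX b p _ (g := fun k => - k%:R) (m := n.+1)); last exact: oppnatS_neq0.
rewrite exprS rmorphM -mulrA /=.
rewrite -(sum_beyond b N n (fun x => lf (- x) ^+ p)) mulr_sumr; apply: eq_bigr => k _.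
rewrite exprS mulrA -rmorphM mulrA -(expr1 (sgn b)) sgn_mul mul1r.
by congr (_ * lf _ ^+ _); rewrite natrD -!natr1; ring.
Qed.

Lemma left_poles_neg b p N n : (n <= N)%N -> exists A,
  left_poles b p N (- n.+1%:R) = (sgn b ^+ n.+1)%:P * (1 + 'X^p * A).
Proof.
move=> nN; have := sum_around b (fun x => lf (- x) ^+ p) nN.
rewrite oppr0 local_factor_eq0 expr1n.
rewrite (local_factor_sumX b p _ (g := fun k => - k%:R) (m := 1)); last exact: oppnatS_neq0.
under [X in _ + (_ + X)]eq_bigr do rewrite opprK.
rewrite (local_factor_sumX b p _ (g := fun k => k%:R) (m := 1)); last exact: natS_neq0.
rewrite -mulrDr; set A := (X in 'X^p * X); move=> e; exists A.
rewrite [sgn b ^+ n.+1]exprS rmorphM -mulrA /= -e mulr_sumr; apply: eq_bigr => k _.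
rewrite exprS rmorphM -mulrA; congr (_ * (_ * lf _ ^+ _)).
by rewrite -!natr1; ring.
Qed.

(** The equations determine both cofactors, since X^p is regular; they are
produced together with their l-th coefficients to share the computation. *)
Lemma coef_poles_half b p N l : exists A,
  [/\ right_poles b p N (- 2^-1) = 'X^p * A.1,
      left_poles b p N (- 2^-1) = 'X^p * A.2,
      A.1`_l = inv_coef p l * ((-1) ^+ (p + l) * half_sum R b (p + l) N) &
      A.2`_l = inv_coef p l * (sgn b * half_sum R b (p + l) N)].
Proof.
have x0 k : k%:R + 2^-1 != 0 :> R by rewrite lt0r_neq0 // ltr_wpDl.
exists (\sum_(0 <= k < N.+1) (sgn b ^+ k)%:P * inv (- (k%:R + 2^-1)) ^+ p,
        \sum_(0 <= k < N.+1) (sgn b ^+ k.+1)%:P * inv (k%:R + 2^-1) ^+ p); split => /=.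
- rewrite -local_factor_sumX; last by move=> k _; rewrite oppr_eq0.
  by apply: eq_bigr => k _; congr (_ * lf _ ^+ _); ring.
- rewrite mulr_sumr; apply: eq_bigr => k _.
  have -> : - 2^-1 + k.+1%:R = k%:R + 2^-1 :> R by rewrite -natr1; field.
  by rewrite local_factorX // mulrCA.
- rewrite coef_sum !mulr_sumr; apply: eq_bigr => k _.
  by rewrite coefCM inv_series_scale invrXN /inv_coef; ring.
- rewrite coef_sum !mulr_sumr; apply: eq_bigr => k _.
  by rewrite coefCM inv_series_scale exprS /inv_coef; ring.
Qed.

Lemma right_poles_fraction F b p N : (forall k, (k < N.+1)%N -> k%:R \in F) ->
  fraction M F 0 p (right_poles b p N).
Proof.
move=> hF; apply: (@fraction_ext _ _ _ _ _ (fun c => \sum_(k < N.+1) (sgn b ^+ k)%:P * lf (c - k%:R) ^+ p)).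
  by apply: fraction_sum => k; apply: fractionZ; apply: fraction_factor => //; exact: hF.
by move=> c; rewrite /right_poles big_mkord.
Qed.
Lemma left_poles_fraction F b p N : (forall k, (k < N.+1)%N -> - k.+1%:R \in F) ->
  fraction M F 0 p (left_poles b p N).
Proof.
move=> hF; apply: (@fraction_ext _ _ _ _ _ (fun c => \sum_(k < N.+1) (sgn b ^+ k.+1)%:P * lf (c - - k.+1%:R) ^+ p)).
  by apply: fraction_sum => k; apply: fractionZ; apply: fraction_factor => //; exact: hF.
by move=> c; rewrite /left_poles big_mkord; apply: eq_bigr => k _; rewrite opprK.
Qed.

(** The constant that compensates the divergence of the sums attached to the
plain index 1; those attached to the other indices converge. *)
Definition comp_cst b p N : R := if ~~ b && (p == 1)%N then harm R N else 0.
(** The limit of the regularized sum (-1)^p T(N) + c_N, see [reg_cst_tends]. *)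
Definition reg_cst b p : R :=
  if ~~ b && (p == 1)%N then 0 else (-1) ^+ p * zeta_value R (bar_index b p).

Lemma red_zeta_value b P : (0 < P)%N -> (b || (1 < P)%N) -> red (zeta_value R (bar_index b P)).
Proof. by case: b => P0 hP; apply: red_value; [exact: LowerZetaBar|exact: LowerZeta]. Qed.

Lemma red_Nexp x n : red x -> red ((-1) ^+ n * x).
Proof. by move=> hx; apply: redM => //; exact: red_sign _ _ true n. Qed.

Lemma conv_cond b p : (0 < p)%N -> ~~ (~~ b && (p == 1)%N) -> b || (1 < p)%N.
Proof. by case: b => //=; case: p => [|[|]]. Qed.

Lemma red_reg_cst b p : (0 < p)%N -> red (reg_cst b p).
Proof.
move=> p0; rewrite /reg_cst; case: ifPn => h; first exact: red0.
by apply: red_Nexp; apply: red_zeta_value => //; exact: conv_cond.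
Qed.

Lemma reg_cst_tends b p : (0 < p)%N ->
  tends (fun N => (-1) ^+ p * T b p N + comp_cst b p N) (reg_cst b p).
Proof.
move=> p0; rewrite /comp_cst /reg_cst; case: ifPn => [/andP[/negPf -> /eqP ->]|h].
  rewrite (_ : (fun N => _) = fun=> 0); first exact: tends_cst.
  by apply/funext => N; rewrite harmE expr1 mulN1r addNr.
rewrite -[X in tends _ X]addr0; apply: tendsD; last exact: tends_cst.
apply: tendsM; first exact: tends_cst.
by apply: signed_sum_tends => //; exact: conv_cond.
Qed.

(** The regular parts of the compensated factors, at n and at -n-1. *)
Definition Wreg b p N n := W_around b p N n + (comp_cst b p N)%:P.
Definition Vreg b p N n := W_before b p N n + (comp_cst b p N)%:P.

Lemma Wreg0 b p N n : (Wreg b p N n)`_0 =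
  T b p n + ((-1) ^+ p * (T b p (N - n) - T b p N) + ((-1) ^+ p * T b p N + comp_cst b p N)).
Proof. by rewrite coefD coefC eqxx coef_W_around inv_coef0 addn0; ring. Qed.
Lemma Vreg0 b p N n : (Vreg b p N n)`_0 =
  - (-1) ^+ p * T b p n + ((-1) ^+ p * (T b p (N + n.+1) - T b p N) + ((-1) ^+ p * T b p N + comp_cst b p N)).
Proof. by rewrite coefD coefC eqxx coef_W_before inv_coef0 addn0; ring. Qed.

Lemma Wreg0_tends b p n : (0 < p)%N ->
  tends (fun N => (Wreg b p N n)`_0) (1 * T b p n + reg_cst b p).
Proof.
move=> p0; rewrite (_ : (fun N => _) = fun N => T b p n + ((-1) ^+ p * (T b p (N - n) - T b p N) + ((-1) ^+ p * T b p N + comp_cst b p N))); last first.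
  by apply/funext => N; rewrite Wreg0.
rewrite mul1r; apply: tendsD; first exact: tends_cst.
rewrite -[X in tends _ X]add0r; apply: tendsD; last exact: reg_cst_tends.
rewrite -[X in tends _ X](mulr0 ((-1) ^+ p)); apply: tendsM; first exact: tends_cst.
exact: signed_sum_backshift.
Qed.
Lemma Vreg0_tends b p n : (0 < p)%N ->
  tends (fun N => (Vreg b p N n)`_0) (- (-1) ^+ p * T b p n + reg_cst b p).
Proof.
move=> p0; rewrite (_ : (fun N => _) = fun N => - (-1) ^+ p * T b p n + ((-1) ^+ p * (T b p (N + n.+1) - T b p N) + ((-1) ^+ p * T b p N + comp_cst b p N))); last first.
  by apply/funext => N; rewrite Vreg0.
apply: tendsD; first exact: tends_cst.
rewrite -[X in tends _ X]add0r; apply: tendsD; last exact: reg_cst_tends.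
rewrite -[X in tends _ X](mulr0 ((-1) ^+ p)); apply: tendsM; first exact: tends_cst.
exact: signed_sum_foreshift.
Qed.

Lemma Wreg_hpoly_coefs b p : (0 < p)%N -> hpoly_coefs r 1 (Wreg b p).
Proof.
move=> p0 [|l].
  apply: hpoly_array_ext (hpoly_arrayD (hpoly_array_signed_sum R r b p0)
    (hpoly_arrayD (hpoly_arrayZ (red_Nexp p (red1 R r)) (hpoly_array_backshift R r 1 b p0))
      (hpoly_array_seq 1 (red_reg_cst b p0) (@reg_cst_tends b p p0)))) _ => N n.
  by rewrite Wreg0 mulr1.
have P0 : (0 < p + l.+1)%N by rewrite addnS.
have P1 : (1 < p + l.+1)%N by lia.
have hP : b || (1 < p + l.+1)%N by rewrite P1 orbT.
apply: hpoly_array_ext (hpoly_arrayZ (red_inv_coef p l.+1) (hpoly_arrayD (hpoly_array_signed_sum R r b P0)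
    (hpoly_arrayZ (red_Nexp (p + l.+1) (red1 R r)) (hpoly_arrayD (hpoly_array_backshift R r 1 b P0)
      (hpoly_array_seq 1 (@red_zeta_value b _ P0 hP) (@signed_sum_tends R b _ P0 hP)))))) _ => N n.
by rewrite mulr1 subrK coefD coefC addr0 coef_W_around.
Qed.

Lemma Vreg0_hpoly_array b p : (0 < p)%N -> hpoly_array r 1 (fun N n => (Vreg b p N n)`_0).
Proof.
move=> p0; apply: hpoly_array_ext (hpoly_arrayD (hpoly_arrayZ (redN (red_Nexp p (red1 R r))) (hpoly_array_signed_sum R r b p0))
    (hpoly_arrayD (hpoly_arrayZ (red_Nexp p (red1 R r)) (hpoly_array_foreshift R r 1 b p0))
      (hpoly_array_seq 1 (red_reg_cst b p0) (@reg_cst_tends b p p0)))) _ => N n.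
by rewrite Vreg0 mulr1.
Qed.

(** The degree is 0: the two one-sided sums at n differ from their limits by
ranges of fixed length, and at order 1 they cancel each other, so that the
limits are constants and zeta(1) does not occur. *)
Lemma kernel_hpoly_coefs b : hpoly_coefs r 0 (fun N n => W_around b 1 N n + W_beyond b 1 N n).
Proof.
move=> l; have P0 : (0 < 1 + l)%N by [].
have [z [hz tz]] : exists z, red z /\ tends (fun N => (1 + (-1) ^+ (1 + l)) * T b (1 + l) N) z.
  case: l P0 => [|l] P0.
    exists 0; split; first exact: red0.
    rewrite (_ : (fun N => _) = fun=> 0); first exact: tends_cst.
    by apply/funext => N; rewrite addn0 expr1 subrr mul0r.
  have hP : b || (1 < 1 + l.+1)%N by rewrite orbT.
  exists ((1 + (-1) ^+ (1 + l.+1)) * zeta_value R (bar_index b (1 + l.+1))); split.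
    apply: redM; last exact: red_zeta_value.
    by apply: redD; [exact: red1|rewrite -[_ ^+ _]mulr1; apply: red_Nexp; exact: red1].
  by apply: tendsM; [exact: tends_cst|exact: signed_sum_tends].
apply: hpoly_array_ext (hpoly_arrayZ (red_inv_coef 1 l) (hpoly_arrayD (hpoly_array_foreshift R r 0 b P0)
   (hpoly_arrayD (hpoly_arrayZ (red_Nexp (1 + l) (red1 R r)) (hpoly_array_backshift R r 0 b P0)) (hpoly_array_seq 0 hz tz)))) _ => N n.
by rewrite mulr1 coefD coef_W_around coef_W_beyond; ring.
Qed.

(** Local expansions whose coefficients tend to reducible numbers. *)
Definition const_series (P : nat -> {poly R}) := forall l, exists z, red z /\ tends (fun N => (P N)`_l) z.

Lemma const_seriesM P Q : const_series P -> const_series Q -> const_series (fun N => P N * Q N).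
Proof.
move=> hP hQ l.
have /choice[f hf] : forall i : 'I_l.+1, exists z, red z /\ tends (fun N => (P N)`_i * (Q N)`_(l - i)) z.
  move=> i; have [x [rx tx]] := hP i; have [y [ry ty]] := hQ (l - i)%N.
  by exists (x * y); split; [exact: redM|exact: tendsM].
exists (\sum_(i < l.+1) f i); split; first by apply: red_sum => i _; exact: (hf i).1.
rewrite (_ : (fun N => _) = fun N => \sum_(i < l.+1) (P N)`_i * (Q N)`_(l - i)).
  by apply: tends_sum => i; exact: (hf i).2.
by apply/funext => N; rewrite coefM.
Qed.

Lemma const_series_prod I (s : seq I) (P : I -> nat -> {poly R}) :
  (forall i, const_series (P i)) -> const_series (fun N => \prod_(i <- s) P i N).
Proof.
move=> h; elim: s => [|i s IH] l.
  exists (1 : {poly R})`_l; split.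
    by rewrite coef1; case: eqP => _; [exact: red1|exact: red0].
  rewrite (_ : (fun N => _) = fun=> (1 : {poly R})`_l); first exact: tends_cst.
  by apply/funext => N; rewrite big_nil.
have [z [rz tz]] := const_seriesM (h i) IH l; exists z; split => //.
by move: tz; congr (tends _ _); apply/funext => N; rewrite big_cons.
Qed.

Lemma red_R_value b P : (0 < P)%N ->
  red (if b then - R_value R (Bar P) else R_value R (Plain P)).
Proof.
case: b => P0; first by apply: redN; apply: red_value; exact: LowerRBar.
by apply: red_value; exact: LowerR.
Qed.

(** The value R(1) = 2 log 2 arises here, as the limit of the compensated sum
for the plain index 1. *)
Lemma right_poles_half b p : (0 < p)%N -> exists B, const_series B /\
  forall N, right_poles b p N (- 2^-1) + (comp_cst b p N)%:P * 'X^p = 'X^p * B N.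
Proof.
move=> p0; have /choice[A hA] : forall N, exists A, right_poles b p N (- 2^-1) = 'X^p * A /\
    forall l, A`_l = inv_coef p l * ((-1) ^+ (p + l) * half_sum R b (p + l) N).
  move=> N; have [A0 [e0 _ _ _]] := coef_poles_half b p N 0; exists A0.1; split => // l.
  have [A [e _ + _]] := coef_poles_half b p N l; suff -> : A0.1 = A.1 by [].
  by apply: (@mulfI _ 'X^p); [rewrite monic_neq0 // monicXn|rewrite -e0 -e].
exists (fun N => A N + (comp_cst b p N)%:P); split; last first.
  by move=> N; rewrite (hA N).1 mulrDr; congr (_ + _); rewrite mulrC.
move=> l.
rewrite (_ : (fun N => _) = fun N => inv_coef p l * ((-1) ^+ (p + l) * half_sum R b (p + l) N) +
    (if (l == 0)%N then comp_cst b p N else 0)); last first.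
  by apply/funext => N; rewrite coefD (hA N).2 coefC.
have P0 : (0 < p + l)%N by lia.
have [/andP[/eqP l0 h]|h] := boolP ((l == 0)%N && (~~ b && (p == 1)%N)).
  exists (- R_value R (Plain 1)); split; first by apply: redN; exact: (red_R_value false).
  rewrite l0 eqxx addn0 inv_coef0 /comp_cst h; case/andP: h => /negPf -> /eqP ->.
  rewrite (_ : (fun N => _) = fun N => - (half_sum R false 1 N - harm R N)).
    by apply: tendsN; exact: half_sum1_tends.
  by apply/funext => N; rewrite expr1 mul1r mulN1r opprB addrC.
exists (inv_coef p l * ((-1) ^+ (p + l) * (if b then - R_value R (Bar (p + l)) else R_value R (Plain (p + l)))) + 0); split.
  apply: redD; last exact: red0.
  by apply: redM; [exact: red_inv_coef|apply: red_Nexp; exact: red_R_value].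
have hP : b || (1 < p + l)%N.
  by apply: conv_cond => //; apply: contra h => /andP[-> /eqP e]; apply/andP; split; apply/eqP; lia.
apply: tendsD.
  apply: tendsM; first exact: tends_cst.
  by apply: tendsM; [exact: tends_cst|exact: half_sum_tends].
rewrite (_ : (fun N => _) = fun=> 0); first exact: tends_cst.
apply/funext => N; case: eqP => // l0; rewrite /comp_cst ifN //.
by move: h; rewrite l0.
Qed.

(** For the trivial character, the contributions of the poles k and -k-1 to the
constant term cancel: no divergent series occurs. *)
Lemma kernel_half b : exists B, const_series B /\
  forall N, right_poles b 1 N (- 2^-1) + left_poles b 1 N (- 2^-1) = 'X * B N.
Proof.
have /choice[A hA] : forall N, exists A, right_poles b 1 N (- 2^-1) + left_poles b 1 N (- 2^-1) = 'X * A /\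
    forall l, A`_l = inv_coef 1 l * (((-1) ^+ (1 + l) + sgn b) * half_sum R b (1 + l) N).
  move=> N; have [A0 [e0 f0 _ _]] := coef_poles_half b 1 N 0; exists (A0.1 + A0.2); split.
    by rewrite e0 f0 -mulrDr.
  move=> l; have [A [e f h1 h2]] := coef_poles_half b 1 N l.
  have x0 : 'X^1 != 0 :> {poly R} by rewrite monic_neq0 // monicXn.
  have -> : A0.1 = A.1 by apply: (mulfI x0); rewrite -e0 -e.
  have -> : A0.2 = A.2 by apply: (mulfI x0); rewrite -f0 -f.
  by rewrite coefD h1 h2; ring.
exists A; split=> [l|N]; last exact: (hA N).1.
rewrite (_ : (fun N => _) = fun N => inv_coef 1 l * (((-1) ^+ (1 + l) + sgn b) * half_sum R b (1 + l) N)); last first.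
  by apply/funext => N; rewrite (hA N).2.
have [h|h] := boolP (b || (1 < 1 + l)%N).
  exists (inv_coef 1 l * (((-1) ^+ (1 + l) + sgn b) * (if b then - R_value R (Bar (1 + l)) else R_value R (Plain (1 + l))))); split.
    apply: redM; first exact: red_inv_coef.
    apply: redM; last exact: red_R_value.
    apply: redD; first by rewrite -[_ ^+ _]mulr1; apply: red_Nexp; exact: red1.
    by have := red_sign R r b 1; rewrite expr1.
  apply: tendsM; first exact: tends_cst.
  by apply: tendsM; [exact: tends_cst|exact: half_sum_tends].
exists 0; split; first exact: red0.
have -> : l = 0%N by move: h; rewrite negb_or; lia.
have -> : b = false by move: h; rewrite negb_or => /andP[/negPf].
rewrite (_ : (fun N => _) = fun=> 0); first exact: tends_cst.
by apply/funext => N; rewrite /sgn addn0 expr1 expr0 addNr mul0r mulr0.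
Qed.
End LocalExpansions.

(** * The parity theorem *)

Section ParityTheorem.
Variables (R : realType) (r : nat) (I : Type) (j : I) (s : seq I).
Variables (b : I -> bool) (p : I -> nat) (q : nat) (beta b0 : bool).
Hypotheses (p0 : forall i, (0 < p i)%N) (q1 : (1 < q)%N) (sr : (size s < r)%N).
Hypothesis signs : sgn R b0 * \prod_(i <- j :: s) sgn R (b i) = sgn R beta.
Hypothesis parity : sgn R beta * (-1) ^+ q * \prod_(i <- j :: s) - (-1) ^+ p i = 1.
Local Notation red := (@reduces_to_lower_orders R r).
Local Notation T := (@signed_sum R).
Local Notation S := (\sum_(i <- j :: s) p i)%N.
Local Notation M := (S + q)%N.
Local Notation lf := (@local_factor R M).
Local Notation inv := (@inv_series R M).
Local Notation inv_coef := (@inv_coef R M).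
Local Notation Wreg := (@Wreg R M).
Local Notation Vreg := (@Vreg R M).

Let M0 : (0 < M)%N. Proof. lia. Qed.

(** The product pi cot (pi s), or pi / sin (pi s), truncated to the poles
from -N-1 to N, a range symmetric around -1/2. *)
Definition kernel N (c : R) := right_poles M b0 1 N c + left_poles M b0 1 N c.
Definition harmonic_factor i N (c : R) :=
  right_poles M (b i) (p i) N c + (comp_cst R (b i) (p i) N)%:P * 'X^(p i).
(** The function f_N of the introduction, through its local expansions. *)
Definition summand N c : {poly R} :=
  kernel N c * (\prod_(i <- j :: s) harmonic_factor i N c * lf (c - - 2^-1) ^+ q).

Definition nodes N : seq R := [seq k%:R | k <- iota 0 N.+1] ++
  ([seq - k.+1%:R | k <- iota 0 N.+1] ++ [:: - 2^-1]).

Lemma uniq_nodes N : uniq (nodes N).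
Proof.
have h1 : uniq [seq k%:R : R | k <- iota 0 N.+1].
  by rewrite map_inj_uniq ?iota_uniq // => m n /eqP; rewrite eqr_nat => /eqP.
have h2 : uniq [seq - k.+1%:R : R | k <- iota 0 N.+1].
  by rewrite map_inj_uniq ?iota_uniq // => m n /oppr_inj /eqP; rewrite eqr_nat => /eqP [].
rewrite /nodes cat_uniq h1 cat_uniq h2 has_seq1 andbT !andTb; apply/andP; split; last first.
  apply/mapP => -[k _ /oppr_inj]; rewrite -(natr1 k) => e.
  have : 0 <= k%:R :> R by []. lra.
apply/hasPn => x; rewrite mem_cat => /orP[/mapP[k _ ->]|]; last rewrite inE => /eqP ->.
  apply/mapP => -[m _]; rewrite -(natr1 k) => e.
  have : 0 <= k%:R :> R by []. have : 0 <= m%:R :> R by []. lra.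
apply/mapP => -[m _] e; have : 0 <= m%:R :> R by []. lra.
Qed.

Lemma summand_fraction N : fraction M (nodes N) 2 (1 + M) (summand N).
Proof.
have hr k : (k < N.+1)%N -> k%:R \in nodes N.
  by move=> kN; rewrite mem_cat map_f // mem_iota.
have hl k : (k < N.+1)%N -> - k.+1%:R \in nodes N.
  by move=> kN; rewrite !mem_cat orbCA; apply/orP; left; apply/mapP; exists k; rewrite // mem_iota.
have hh : - 2^-1 \in nodes N by rewrite !mem_cat mem_seq1 eqxx !orbT.
apply: (fractionM (e1 := 0) (e2 := 2)).
  by apply: fractionD; [exact: right_poles_fraction|exact: left_poles_fraction].
apply: (fractionM (e1 := 0) (e2 := 2)); last exact: fraction_factor.
apply: fraction_prod => i; apply: fractionD; first exact: right_poles_fraction.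
exact: fraction_monomial.
Qed.

Lemma sum_residues N :
  \sum_(0 <= n < N.+1) (summand N n%:R)`_M +
  (\sum_(0 <= n < N.+1) (summand N (- n.+1%:R))`_M + (summand N (- 2^-1))`_M) = 0.
Proof.
rewrite -[RHS](fraction_residue (uniq_nodes N) _ (summand_fraction N)) //.
by rewrite /nodes !big_cat !big_map big_seq1 /= /index_iota subn0.
Qed.

Lemma sgn_comp_cst i n N : sgn R (b i) ^+ n * comp_cst R (b i) (p i) N = comp_cst R (b i) (p i) N.
Proof.
rewrite /comp_cst; case: ifP => [/andP[/negPf -> _]|_]; last by rewrite mulr0.
by rewrite /sgn expr0 expr1n mul1r.
Qed.

Lemma prod_sgn n : (sgn R b0 ^+ n)%:P * \prod_(i <- j :: s) (sgn R (b i) ^+ n)%:P =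
  (sgn R beta ^+ n)%:P :> {poly R}.
Proof.
rewrite -signs exprMn rmorphM /= -prodrXl rmorph_prod //.
Qed.

Lemma harmonic_factor_nat i N n : (n <= N)%N -> harmonic_factor i N n%:R =
  (sgn R (b i) ^+ n)%:P * (1 + 'X^(p i) * Wreg (b i) (p i) N n).
Proof.
move=> nN; rewrite /harmonic_factor right_poles_nat // /Wreg.
by rewrite -{1}(sgn_comp_cst i n N) rmorphM /=; ring.
Qed.

Lemma harmonic_factor_neg i N n : harmonic_factor i N (- n.+1%:R) =
  (sgn R (b i) ^+ n.+1)%:P * ('X^(p i) * Vreg (b i) (p i) N n).
Proof.
rewrite /harmonic_factor right_poles_neg // /Vreg.
by rewrite -{1}(sgn_comp_cst i n.+1 N) rmorphM /=; ring.
Qed.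

Lemma half_neq0 n : n%:R + 2^-1 != 0 :> R.
Proof. by rewrite lt0r_neq0 // ltr_wpDl. Qed.

Definition main_nat N n := \prod_(i <- j :: s) (Wreg (b i) (p i) N n)`_0.
Definition main_neg N n := \prod_(i <- j :: s) (Vreg (b i) (p i) N n)`_0.

Lemma coef0_prod (A : I -> {poly R}) t : (\prod_(i <- t) A i)`_0 = \prod_(i <- t) (A i)`_0.
Proof.
by rewrite -horner_coef0 horner_prod; apply: eq_bigr => i _; rewrite horner_coef0.
Qed.

(** The harmonic factors have no pole at -n-1, so that the residue is that of
the kernel multiplied by their values. *)
Lemma summand_neg N n : (n <= N)%N ->
  (summand N (- n.+1%:R))`_M =
  weighted beta q (fun n => sgn R beta * (-1) ^+ q * main_neg N n) n.
Proof.
move=> nN; rewrite /summand /kernel right_poles_neg //.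
have [A ->] := left_poles_neg R M b0 1 nN.
rewrite (eq_bigr _ (fun i _ => harmonic_factor_neg i N n)).
rewrite !big_split /=.
rewrite (_ : - n.+1%:R - - 2^-1 = - (n%:R + 2^-1)); last by rewrite -(natr1 n); field.
rewrite local_factorX ?oppr_eq0 ?half_neq0 //.
rewrite -(big_morph _ (fun x y => exprD 'X x y) (expr0 _)).
set P := \prod_(_ <- _) Vreg _ _ _ _; set B := W_before _ _ _ _ _ _.
(* All the signs combine into the n.+1-th power of the target sign. *)
rewrite (_ : _ * _ = 'X^M * ((sgn R beta ^+ n.+1)%:P * ((1 + 'X * (A + B)) *
   (P * inv (- (n%:R + 2^-1)) ^+ q)))); last by rewrite -prod_sgn exprD; ring.
rewrite coefXnM ltnn subnn coefCM mulrDl mul1r -mulrA coefD coefXM addr0.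
rewrite -!horner_coef0 hornerM !horner_coef0 coef0_prod -/(main_neg N n).
rewrite inv_series_scale addn0 inv_series0 // mul1r invrXN /weighted exprS; ring.
Qed.

(** The main term picks the pole of the kernel and the values of the regular
parts of all the harmonic factors. In the other terms, the coefficient of
index S - i of the expansion of (s + 1/2)^(-q) raises the exponent q. *)
Lemma summand_nat : exists C : nat -> nat -> nat -> R,
  (forall i, hpoly_array r (size s) (C i)) /\ forall N n, (n <= N)%N ->
  (summand N n%:R)`_M = weighted beta q (main_nat N) n +
    \sum_(i < S.+1) weighted beta (q + (S - i)) (C i N) n.
Proof.
have [E [hE eE]] := hpoly_coefs_prod_poles j s p (fun i => Wreg_hpoly_coefs R r M0 (b i) (p0 i)).
pose kap N n := W_around R M b0 1 N n + W_beyond R M b0 1 N n.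
have hk : hpoly_coefs r 0 kap := kernel_hpoly_coefs R r M0 b0.
have hC : hpoly_coefs r (size s) (fun N n => E N n + 'X^1 * (kap N n * E N n)).
  by apply: hpoly_coefsD => //; apply: hpoly_coefsXn; exact: (hpoly_coefsM hk hE).
exists (fun i N n => inv_coef q (S - i) * (E N n + 'X^1 * (kap N n * E N n))`_i); split.
  by move=> i; apply: hpoly_arrayZ; [exact: red_inv_coef|exact: hC].
move=> N n nN; rewrite /summand /kernel right_poles_nat // left_poles_nat //.
rewrite (eq_bigr _ (fun i _ => harmonic_factor_nat i nN)).
rewrite big_split /= eE opprK local_factorX ?half_neq0 //.
set P := \prod_(_ <- _) Wreg _ _ _ _; set V := inv _ ^+ q.
rewrite (_ : _ * _ = 'X^q * ((sgn R beta ^+ n)%:P * ('X^S * (P * V + 'X * (kap N n * (P * V))) +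
   (E N n + 'X^1 * (kap N n * E N n)) * V))); last by rewrite -prod_sgn /kap; ring.
rewrite coefXnM ltnNge leq_addl addnK /= coefCM coefD coefXnM ltnn subnn coefD coefXM addr0.
rewrite mulrDr; congr (_ + _).
  rewrite -horner_coef0 hornerM !horner_coef0 coef0_prod -/(main_nat N n) /V.
  by rewrite inv_series_scale addn0 inv_series0 // mul1r /weighted mulrA.
rewrite coefM mulr_sumr; apply: eq_bigr => i _.
by rewrite /V inv_series_scale /weighted /inv_coef; ring.
Qed.

(** All the factors but the last are regular at -1/2, where the pole has order
q: the residue is a Taylor coefficient of index q - 1. *)
Lemma summand_half : exists z, red z /\ tends (fun N => (summand N (- 2^-1))`_M) z.
Proof.
have [A [hA eA]] := kernel_half R r M0 b0.
have /choice[B hB] := fun i => right_poles_half R r M0 (b i) (p0 i).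
have hAB := const_seriesM hA (const_series_prod (j :: s) (fun i => (hB i).1)).
have [z [rz tz]] := hAB q.-1; exists z; split => //.
move: tz; congr (tends _ _); apply/funext => N.
rewrite /summand /kernel eA subrr.
rewrite local_factor_eq0 expr1n mulr1.
rewrite (eq_bigr _ (fun i _ => (hB i).2 N)).
rewrite big_split /= -(big_morph _ (fun x y => exprD 'X x y) (expr0 _)).
set P := \prod_(_ <- _) B _ _.
rewrite (_ : _ * (_ * P) = 'X^(S.+1) * (A N * P)); last by rewrite exprS; ring.
by rewrite coefXnM ifN; [congr (_`_ _); lia|lia].
Qed.

(** By the parity hypothesis the limits at n and -n-1 have the same main term,
whence the factor 2; all the other limits are reducible. *)
Lemma bilateral_sum_red : exists l, red l /\
  tends (psum (weighted beta q (fun n => \prod_(i <- j :: s) T (b i) (p i) n))) l.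
Proof.
have [C [hC eC]] := summand_nat.
have [z [rz tz]] := summand_half.
have hrc i : red (reg_cst R (b i) (p i)) by exact: red_reg_cst.
have rs i : red (- (-1) ^+ p i).
  by apply: redN; rewrite -[_ ^+ _]mulr1; apply: red_Nexp; exact: red1.
have [h1 [hh1 e1]] := hpoly_prod_shift j s b p0 (fun=> red1 R r) hrc.
have [h2 [hh2 e2]] := hpoly_prod_shift j s b p0 rs hrc.
pose sg := sgn R beta * (-1) ^+ q.
have rsg : red sg.
  apply: redM; first by have := red_sign R r beta 1; rewrite expr1.
  by rewrite -[_ ^+ _]mulr1; apply: red_Nexp; exact: red1.
pose a N n := main_nat N n + sg * main_neg N n.
pose F n := 2 * \prod_(i <- j :: s) T (b i) (p i) n + (h1 n + sg * h2 n).
have ta n : tends (a^~ n) (F n).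
  have -> : F n = \prod_(i <- j :: s) (1 * T (b i) (p i) n + reg_cst R (b i) (p i)) +
      sg * \prod_(i <- j :: s) (- (-1) ^+ p i * T (b i) (p i) n + reg_cst R (b i) (p i)).
    rewrite e1 e2 big1 // mulrDr mulrA -/sg (_ : sg * \prod_(i <- j :: s) - (-1) ^+ p i = 1) //.
    by rewrite /F; ring.
  apply: tendsD; first by apply: tends_prod => i; exact: Wreg0_tends.
  apply: tendsM; first exact: tends_cst.
  by apply: tends_prod => i; exact: Vreg0_tends.
have ba : array_bounded a.
  have W1 i : hpoly_array r 1 (fun N n => (Wreg (b i) (p i) N n)`_0) by exact: (Wreg_hpoly_coefs R r M0 (b i) (p0 i) 0).
  have V1 i := Vreg0_hpoly_array R r M0 (b i) (p0 i).
  have pr (A : I -> nat -> nat -> R) : (forall i, hpoly_array r 1 (A i)) -> forall t,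
      array_bounded (fun N n => \prod_(i <- t) A i N n).
    move=> hA; elim=> [|i t IH].
      exists 1, 0%N; split=> // N n _; by rewrite big_nil expr0 mulr1 normr1.
    have := array_boundedM (hA i).2 IH; congr array_bounded.
    by apply/funext => N; apply/funext => n; rewrite big_cons.
  apply: array_boundedD; first exact: pr.
  apply: array_boundedM; last exact: pr.
  by case: (hpoly_array_cst 0 rsg).
have [l [hl tl]] := weighted_tannery beta q1 ba ta.
have /choice[c hc] : forall i : 'I_S.+1, exists z, red z /\
    tends (fun N => psum (weighted beta (q + (S - i)) (C i N)) N) z.
  by move=> i; apply: (hpoly_array_tannery beta _ sr (hC i)); lia.
have tot : tends (fun N => psum (weighted beta q (a N)) N +
    (\sum_(i < S.+1) psum (weighted beta (q + (S - i)) (C i N)) N + (summand N (- 2^-1))`_M))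
    (l + (\sum_(i < S.+1) c i + z)).
  apply: tendsD => //; apply: tendsD => //.
  by apply: tends_sum => i; exact: (hc i).2.
have l0 : l = - (\sum_(i < S.+1) c i + z).
  apply/eqP; rewrite -addr_eq0; apply/eqP; apply: (tends_uniq tot).
  rewrite (_ : (fun N => _) = fun=> 0); first exact: tends_cst.
  apply/funext => N; rewrite -[RHS](sum_residues N) addrA [RHS]addrA; congr (_ + _).
  rewrite /psum exchange_big -big_split -big_split /=; apply: eq_big_nat => n /andP[_ nN].
  rewrite (eC N n nN) (@summand_neg N n nN). rewrite [RHS]addrAC; congr (_ + _).
  by rewrite /weighted /a -mulrDl -mulrDr.
have rl : red l.
  by rewrite l0; apply: redN; apply: redD => //; apply: red_sum => i _; exact: (hc i).1.
have hh : hpoly r (size s) (fun n => h1 n + sg * h2 n).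
  by apply: hpolyD => //; exact: (hpolyM (hpoly_cst 0 rsg) hh2).
have [m [rm tm]] := hpoly_series beta q1 sr hh.
exists (2^-1 * (l - m)); split.
  by apply: redM; [exact: red_half|apply: redD => //; exact: redN].
rewrite (_ : psum _ = fun N => 2^-1 * (psum (weighted beta q F) N -
   psum (weighted beta q (fun n => h1 n + sg * h2 n)) N)).
  by apply: tendsM; [exact: tends_cst|exact: tendsB].
apply/funext => N; rewrite /psum -sumrB mulr_sumr; apply: eq_bigr => n _.
by rewrite /weighted /F; field.
Qed.
End ParityTheorem.

Lemma prod_sgnE (R : realType) I (t : seq I) (b : I -> bool) :
  exists c, \prod_(i <- t) sgn R (b i) = sgn R c.
Proof.
elim: t => [|i t [c IH]]; first by exists false; rewrite big_nil /sgn expr0.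
by exists (b i (+) c); rewrite big_cons IH /sgn signr_addb.
Qed.

Lemma Rsum_red (R : realType) (r : nat) (p : 'I_r -> nat) (q : nat)
    (e : 'I_r -> eindex) (beta : bool)
    (hr : (1 <= r)%N) (hp : forall j, (1 <= p j)%N) (hq : (1 < q)%N)
    (he : forall j, e j = Plain (p j) \/ e j = Bar (p j)) :
  odd (\sum_(j < r) p j + q) = odd r (+) beta ->
  reduces_to_lower_orders r (Rsum R e (bar_index beta q)).
Proof.
move=> par; pose b j := if e j is Bar _ then true else false.
have eb j : e j = bar_index (b j) (p j).
  by rewrite /b; case: (he j) => ->.
have [j [s es]] : exists j s, index_enum 'I_r = j :: s.
  case E : (index_enum 'I_r) => [|j s]; last by exists j, s.
  by have := mem_index_enum (Ordinal hr); rewrite E.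
have ss : (size s).+1 = r.
  by rewrite -[LHS]/(size (j :: s)) -es -[RHS]card_ord cardE /enum_mem size_filter count_predT.
have [c ec] := prod_sgnE R (j :: s) b.
have signs : sgn R (beta (+) c) * \prod_(i <- j :: s) sgn R (b i) = sgn R beta.
  by rewrite ec /sgn -signr_addb -addbA addbb addbF.
have parity : sgn R beta * (-1) ^+ q * \prod_(i <- j :: s) - (-1) ^+ p i = 1.
  have -> : \prod_(i <- j :: s) - (-1) ^+ p i = (-1) ^+ (size (j :: s) + \sum_(i <- j :: s) p i) :> R.
    rewrite exprD; elim: (j :: s) => [|i t IH].
      by rewrite !big_nil mulr1.
    by rewrite !big_cons IH exprS exprD; ring.
  rewrite [size _]ss -es -!exprD -signr_odd !oddD oddb.
  move: par; rewrite oddD; move: (odd (\sum_(i < r) p i)) (odd q) (odd r) => x y z.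
  by case: beta {signs} x y z => [] [] [] [].
have ls : (size s < r)%N by move: ss; lia.
have [l [rl tl]] := bilateral_sum_red hp hq ls signs parity.
have -> : Rsum R e (bar_index beta q) = sgn R c * l.
  apply: Rsum_weighted.
  rewrite (_ : psum _ = fun n => sgn R c * psum (weighted beta q (fun n => \prod_(i <- j :: s) signed_sum R (b i) (p i) n)) n).
    by apply: tendsM => //; exact: tends_cst.
  apply/funext => N; rewrite /psum mulr_sumr; apply: eq_bigr => n _.
  rewrite /weighted -ec -es (eq_bigr (fun j => sgn R (b j) * signed_sum R (b j) (p j) n)).
    by rewrite big_split /=; ring.
  by move=> i _; rewrite harmonic_sumE eb; case: (b i).
by apply: redM => //; have := red_sign R r c 1; rewrite expr1.
Qed.

Theorem theorem3p6 (R : realType) (r : nat) (p : 'I_r -> nat) (q : nat)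
    (e : 'I_r -> eindex)
    (hr : (1 <= r)%N) (hp : forall j, (1 <= p j)%N) (hq : (1 < q)%N)
    (he : forall j, e j = Plain (p j) \/ e j = Bar (p j)) :
  (odd (\sum_(j < r) p j + q)%N = odd r ->
     reduces_to_lower_orders r (Rsum R e (Plain q))) /\
  (odd (\sum_(j < r) p j + q)%N <> odd r ->
     reduces_to_lower_orders r (Rsum R e (Bar q))).
Proof.
split=> par.
  by apply: (@Rsum_red R r p q e false) => //; rewrite addbF.
apply: (@Rsum_red R r p q e true) => //; rewrite addbT.
by move: par; case: (odd r); case: (odd _).
Qed.
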